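(* Let $\mathcal X$ be a separable metric space, let $K(x,y)$ be a Calderón–Zygmund kernel on $\mathcal X$ with parameters $A,s,\delta$, and let $\eta\in\Sigma_s$ (with the same $s$). For $\varepsilon>0$ set $$\mathfrak R_{\eta,\varepsilon}^Kf(x)=\int_{\mathcal X\setminus\mathcal B(x,\varepsilon)}K(x,y)f(y)\,d\eta(y).$$ Suppose that $$\|\mathfrak R_{\eta,\varepsilon}^K\chi_Q\|_{L^2(\eta|Q)}^2\le C\,\eta(Q),\qquad C=C(A,s,\delta),$$ for every measurable set $Q$ (and every $\varepsilon>0$), where the constant $C$ depends only on $A,s,\delta$. Then the operators $\mathfrak R_{\eta,\varepsilon}^K$ are uniformly bounded with respect to $\varepsilon>0$, that is, $$\|\mathfrak R_{\eta,\varepsilon}^K\|_{L^2(\eta)\to L^2(\eta)}\le C',\qquad C'=C'(A,s,\delta),$$ where $C'$ depends only on $A,s,\delta$.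
   Context: $\mathcal X$ is a metric space with distance $\operatorname{dist}$, and $\mathcal B(x,r)=\{y\in\mathcal X:\operatorname{dist}(x,y)<r\}$. $\eta|Q$ is the restriction of $\eta$ to $Q$. A function $K:\mathcal X\times\mathcal X\to\mathbb C$ is a Calderón–Zygmund (CZ) kernel with parameters $A>0$, $s>0$, $\delta\in(0,1]$ if $$|K(x,y)|\le\frac{A}{\operatorname{dist}(x,y)^s},\qquad |K(x,y)-K(x',y)|,\ |K(y,x)-K(y,x')|\le A\,\frac{\operatorname{dist}(x,x')^\delta}{\operatorname{dist}(x,y)^{s+\delta}}$$ whenever $x,x',y\in\mathcal X$ (with $x\neq y$) and $\operatorname{dist}(x,x')\le\frac12\operatorname{dist}(x,y)$. $\Sigma_s$ is the class of finite nonnegative Borel measures $\eta$ in $\mathcal X$ such that $\eta(\mathcal B(x,r))\le r^s$ for all $x\in\mathcal X$, $r>0$. *)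

(* Defs.v *)
From HB Require Import structures.
From mathcomp Require Import all_boot all_order all_algebra.
From mathcomp Require Import all_classical all_reals all_analysis.
From mathcomp Require Import complex.
Set Implicit Arguments.
Unset Strict Implicit.
Unset Printing Implicit Defensive.
Import Order.TTheory GRing.Theory Num.Theory.
Import numFieldNormedType.Exports.
Local Open Scope classical_set_scope.
Local Open Scope ring_scope.

(* Measurable types are pointed in MathComp-Analysis, so a metric space that
   carries a Borel measure has to be pointed (hence nonempty). *)
#[short(type="pmetricType")]
HB.structure Definition PointedMetric (K : numDomainType) :=
  {M of Metric K M & Pointed M}.

Notation borel X := (g_sigma_algebraType (@open X)).

(* The modulus as an element of R; the norm on R[i] takes values in R[i]. *)
Notation cabs := ComplexField.Normc.normc.

Definition separable (T : topologicalType) : Prop :=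
  exists2 D : set T, countable D & dense D.

Section complex_L2.
Context {d : measure_display} {T : measurableType d} {R : realType}.
Variable mu : {measure set T -> \bar R}.

Definition cmeasurable (f : T -> R[i]) : Prop :=
  measurable_fun setT (fun x => complex.Re (f x)) /\
  measurable_fun setT (fun x => complex.Im (f x)).

(* Rintegral returns a default value when the integrand is not integrable;
   for a truncated Calderon-Zygmund kernel, a finite measure and a function in
   L^2 the integrand is integrable. *)
Definition cintegral (D : set T) (f : T -> R[i]) : R[i] :=
  Complex (\int[mu]_(x in D) complex.Re (f x))
          (\int[mu]_(x in D) complex.Im (f x)).

Definition L2norm (f : T -> R[i]) : \bar R :=
  Lnorm mu 2%:E (fun x => (cabs (f x))%:E).

Definition inL2 (f : T -> R[i]) : Prop :=
  cmeasurable f /\ (L2norm f < +oo)%E.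

Definition L2_opnorm (U : (T -> R[i]) -> (T -> R[i])) : \bar R :=
  ereal_sup [set L2norm (U f) | f in [set f | inL2 f /\ (L2norm f <= 1)%E]].

End complex_L2.

Section CZ.
Context {R : realType} {X : pmetricType R}.

Definition CZ_kernel (A s delta : R) (K : X -> X -> R[i]) : Prop :=
  [/\ 0 < A, 0 < s, 0 < delta <= 1,
    (forall x y : X, x <> y -> cabs (K x y) <= A / (mdist x y `^ s)) &
    (forall x x' y : X, x <> y -> mdist x x' <= mdist x y / 2 ->
      cabs (K x y - K x' y)
        <= A * (mdist x x' `^ delta / mdist x y `^ (s + delta)) /\
      cabs (K y x - K y x')
        <= A * (mdist x x' `^ delta / mdist x y `^ (s + delta)))].

Definition Sigma (s : R) (eta : {finite_measure set (borel X) -> \bar R}) :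
    Prop :=
  forall (x : X) (r : R), 0 < r -> (eta (ball x r) <= (r `^ s)%:E)%E.

Definition truncated_op (K : X -> X -> R[i])
    (eta : {finite_measure set (borel X) -> \bar R}) (eps : R)
    (f : borel X -> R[i]) : borel X -> R[i] :=
  fun x => cintegral eta (~` ball (x : X) eps) (fun y => K x y * f y).

End CZ.

(* Main.v *)
Require Import Defs.
From mathcomp Require Import all_boot all_order all_algebra.
From mathcomp Require Import all_classical all_reals all_analysis.
From mathcomp Require Import measurable_realfun complex.
From mathcomp Require Import ring lra.
Set Implicit Arguments.
Unset Strict Implicit.
Unset Printing Implicit Defensive.
Import Order.TTheory GRing.Theory Num.Theory.
Import numFieldNormedType.Exports.
Local Open Scope ring_scope.

(** The restricted hypothesis, applied to Q, E and their union, bounds the form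
    B(Q, E) = int_E T chi_Q by C (eta Q + eta E), hence also the L^1 norm of
    T chi_Q on E; the assertion is symmetric under transposition of K. A Cotlar
    argument with doubling balls and the Vitali lemma bounds the maximal
    truncation of T chi_E pointwise by C + w with int w <= C eta E. Given Q and
    t > 0, the mass of Q is then spread out greedily, each point filling the
    nearest free capacity with density at most t. Off the set G that is filled
    up, of measure at most eta Q / t, a set E is separated from each point of Q
    at the scale on which that point was spread, so that T chi_E at this point is
    at most C plus the average of w over the spread mass. Therefore
    int_Q |T chi_E| <= C (eta Q + t eta E) if E avoids G, and iterating on
    E cap G with t = 2^-n, 2^-(n-1), ..., 1 gives
    int_Q |T chi_E| <= C ((n + 1) eta Q + 2^-n eta E) for all Q, E and n.
    This also holds for the transposed kernel, and summing over dyadic level sets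
    of f and g with n = 2 |i - j| yields |int g T f| <= C (|f|^2 + |g|^2).

    All this is done for finitely many weighted points. The operator truncated at
    eps is compared with such a model by cutting the space into cells much
    smaller than eps, the distances being replaced by max(dist, eps): with respect
    to this distance the sharply truncated kernel is still a Calderon-Zygmund
    kernel, and the error is controlled by Schur's test. *)

(** * Restricted bounds on finite sets of points *)

(** Characteristic functions do not scale, so the symmetric bound C (eta Q + eta E) cannot be
    interpolated as it stands. If chi_F and chi_E enter with heights 2^a and 2^b, b <= a, it
    produces the term 2^(a+b) eta E, which exceeds the admissible 4^b eta E by 2^(a-b), and the sum
    over a is out of control. What is wanted is a factor of order 4^-(a-b) in front of eta E; in
    front of eta F a loss is harmless as long as its quotient by 2^(a-b) is summable, so a
    logarithmic one is affordable.

    Such an asymmetric gain has to come from geometry. The excess w is integrable with total mass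
    O(eta E), but its values at single points of Q are not controlled; replacing each value by an
    average against a density at most t turns the total contribution of w into t times eta E.

    On finite sets the extremal radii and points exist, the greedy choices raise no question of
    measurability, and every quantity is finite, so that terms can be absorbed. No constant depends
    on the number of points. *)

Section FiniteKernels.
Context {R : realType} {V : finType}.
Implicit Types (m f g : V -> R) (k : V -> V -> R) (P Q E : pred V) (i j : V).

Definition mass m P : R := \sum_(j | P j) m j.

Definition kint k m P i : R := \sum_(j | P j) k i j * m j.

Definition pairing k m Q E : R := \sum_(i | E i) m i * kint k m Q i.

Definition transposed k i j : R := k j i.

Lemma pairing_transposed k m Q E :
  pairing (transposed k) m Q E = pairing k m E Q.
Proof.
rewrite /pairing /kint.
under eq_bigr do rewrite big_distrr.
rewrite exchange_big /=; apply: eq_bigr => j _.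
by rewrite big_distrr /=; apply: eq_bigr => i _; rewrite /transposed; ring.
Qed.

Lemma mass_ge0 m P : (forall i, 0 <= m i) -> 0 <= mass m P.
Proof. by move=> m0; apply: sumr_ge0. Qed.

Lemma ler_sum_pred f P Q : (forall i, 0 <= f i) -> (forall i, P i -> Q i) ->
  \sum_(i | P i) f i <= \sum_(i | Q i) f i.
Proof.
move=> f0 PQ.
rewrite [leRHS](bigID P) /= (eq_bigl P) ?lerDl ?sumr_ge0 // => i.
by apply/andP/idP => [[]//|Pi]; split => //; exact: PQ.
Qed.

Lemma le_mass m P Q : (forall i, 0 <= m i) -> (forall i, P i -> Q i) ->
  mass m P <= mass m Q.
Proof. exact: ler_sum_pred. Qed.

Lemma kint_split k m P Q i :
  kint k m P i = kint k m [pred j | P j && Q j] i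
               + kint k m [pred j | P j && ~~ Q j] i.
Proof. by rewrite /kint (bigID Q). Qed.

Lemma mass_split m P Q :
  mass m P = mass m [pred j | P j && Q j] + mass m [pred j | P j && ~~ Q j].
Proof. by rewrite /mass (bigID Q). Qed.

Lemma pairing_splitl k m P Q E :
  pairing k m P E = pairing k m [pred j | P j && Q j] E
                  + pairing k m [pred j | P j && ~~ Q j] E.
Proof.
by rewrite /pairing -big_split; apply: eq_bigr => i _; rewrite (kint_split _ _ _ Q) mulrDr.
Qed.

Lemma pairing_splitr k m P Q E :
  pairing k m P E = pairing k m P [pred j | E j && Q j]
                  + pairing k m P [pred j | E j && ~~ Q j].
Proof. by rewrite /pairing (bigID Q). Qed.

Lemma eq_kint k m P Q : P =1 Q -> kint k m P =1 kint k m Q.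
Proof. by move=> PQ i; exact: eq_bigl. Qed.

Lemma eq_pairing k m P Q E F : P =1 Q -> E =1 F ->
  pairing k m P E = pairing k m Q F.
Proof.
move=> PQ EF; rewrite /pairing (eq_bigl _ _ EF).
by apply: eq_bigr => i _; rewrite (eq_kint _ _ PQ).
Qed.

(** If [F] lies in [S], the hypothesis at [S] bounds the pairing of [S] with [F]. For disjoint sets
    this is applied to their union and the diagonal term is subtracted; in general [Q] and [E] are
    cut along their intersection. *)
Lemma pairing_bound k m (C : R) : (forall i, 0 <= m i) -> 0 <= C ->
  (forall S, \sum_(i | S i) m i * `|kint k m S i| <= C * mass m S) ->
  forall Q E, `|pairing k m Q E| <= 4 * C * (mass m Q + mass m E).
Proof.
move=> m0 C0 T1.
have sub (F S : pred V) : (forall i, F i -> S i) ->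
    `|pairing k m S F| <= C * mass m S.
  move=> FS; apply: le_trans (T1 S).
  apply: le_trans (ler_norm_sum _ _ _) _.
  under eq_bigr do rewrite normrM (ger0_norm (m0 _)).
  apply: ler_sum_pred => // i.
  by rewrite mulr_ge0.
have disj (P E : pred V) : (forall i, P i -> ~~ E i) ->
    `|pairing k m P E| <= 2 * C * (mass m P + mass m E).
  move=> PE; pose S := [pred j | P j || E j].
  have mS : mass m S = mass m E + mass m P.
    rewrite (mass_split _ _ E); congr (_ + _); apply: eq_bigl => i /=.
      by case: (E i); rewrite ?orbT ?andbF.
    by have := PE i; case: (P i); case: (E i) => // /(_ isT).
  have -> : pairing k m P E = pairing k m S E - pairing k m E E.
    rewrite (pairing_splitl _ _ S E) addrAC.
    rewrite (_ : pairing k m [pred j | S j && E j] E = pairing k m E E).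
      rewrite subrr add0r; apply: eq_pairing => // i /=.
      by have := PE i; case: (P i); case: (E i) => // /(_ isT).
    by apply: eq_pairing => // i /=; case: (E i); rewrite ?orbT ?andbF.
  have h1 : `|pairing k m S E| <= C * mass m S.
    by apply: sub => i /= ->; rewrite orbT.
  have h2 : `|pairing k m E E| <= C * mass m E by exact: sub.
  apply: le_trans (ler_normB _ _) _.
  have := mass_ge0 P m0; have := mass_ge0 E m0; rewrite mS in h1; nra.
move=> Q E.
rewrite (pairing_splitl _ _ Q E).
rewrite (pairing_splitr _ _ [pred j | Q j && E j] Q E).
have h1 : `|pairing k m [pred j | Q j && ~~ E j] E| <=
    2 * C * (mass m [pred j | Q j && ~~ E j] + mass m E).
  by apply: disj => i /= /andP[].
have h2 : `|pairing k m [pred j | Q j && E j] [pred j | E j && ~~ Q j]| <=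
    2 * C * (mass m [pred j | Q j && E j] + mass m [pred j | E j && ~~ Q j]).
  by apply: disj => i /= /andP[-> ->].
have h3 : `|pairing k m [pred j | Q j && E j] [pred j | E j && Q j]| <=
    C * mass m [pred j | Q j && E j].
  by apply: sub => i /= /andP[-> ->].
have e1 := mass_split m Q E; have e2 := mass_split m E Q.
have p1 := mass_ge0 [pred j | Q j && E j] m0.
have p2 := mass_ge0 [pred j | Q j && ~~ E j] m0.
have p3 := mass_ge0 [pred j | E j && ~~ Q j] m0.
have p4 := mass_ge0 [pred j | E j && Q j] m0.
have t1 : forall a b c : R, `|a + b + c| <= `|a| + `|b| + `|c|.
  by move=> a b c; apply: le_trans (ler_normD _ _) _; rewrite lerD2r ler_normD.
apply: le_trans (t1 _ _ _) _.
set x := `|pairing _ _ _ [pred j | E j && Q j]| in h3 *.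
set y := `|pairing _ _ _ [pred j | E j && ~~ Q j]| in h2 *.
set z := `|pairing _ _ _ E| in h1 *.
move: h1 h2 h3; rewrite e1 e2.
set a := mass _ _ in p1 *; set b := mass _ _ in p2 *.
set c := mass _ _ in p4 *; set e := mass _ _ in p3 *.
nra.
Qed.

(** The sign of [kint k m Q] cuts [E] into two sets, on each of which the sum is a pairing up to
    sign. *)
Lemma sum_norm_kint_le k m (C : R) : (forall i, 0 <= m i) -> 0 <= C ->
  (forall Q E, `|pairing k m Q E| <= C * (mass m Q + mass m E)) ->
  forall Q E, \sum_(i | E i) m i * `|kint k m Q i|
              <= 2 * C * (mass m Q + mass m E).
Proof.
move=> m0 C0 H Q E; rewrite (bigID [pred i | 0 <= kint k m Q i]) /=.
have h1 := H Q [pred i | E i && (0 <= kint k m Q i)].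
have h2 := H Q [pred i | E i && ~~ (0 <= kint k m Q i)].
rewrite (_ : \sum_(i | E i && (0 <= kint k m Q i)) m i * `|kint k m Q i| =
   pairing k m Q [pred i | E i && (0 <= kint k m Q i)]); last first.
  by apply: eq_bigr => i /andP[_ h]; rewrite ger0_norm.
rewrite (_ : \sum_(i | E i && ~~ (0 <= kint k m Q i)) m i * `|kint k m Q i| =
   - pairing k m Q [pred i | E i && ~~ (0 <= kint k m Q i)]); last first.
  rewrite -sumrN; apply: eq_bigr => i /andP[_]; rewrite -ltNge => h.
  by rewrite ltr0_norm // mulrN.
have := mass_split m E [pred i | 0 <= kint k m Q i] => /= e.
move: h1 h2; rewrite !ler_norml => /andP[_ h1] /andP[h2 _].
move: h1 h2; rewrite e.
have := mass_ge0 Q m0.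
have p1 := mass_ge0 [pred i | E i && (0 <= kint k m Q i)] m0.
have p2 := mass_ge0 [pred i | E i && ~~ (0 <= kint k m Q i)] m0.
nra.
Qed.

End FiniteKernels.

(** * Covering, and spreading of mass *)

Section GrowthSpaces.
Context {R : realType} {V : finType}.
Implicit Types (m : V -> R) (d k : V -> V -> R) (P Q E U S : pred V) (i j : V).

Definition dball d i (r : R) : pred V := [pred j | d i j < r].

(* The diagonal of [d] need not vanish: in the application [d] is the distance
   cut off from below at the truncation radius, which makes every kernel
   value on the diagonal harmless. *)
Record growth_space m d (G s : R) : Prop := GrowthSpace {
  gs_mass : forall i, 0 <= m i;
  gs_pos : forall i j, 0 < d i j;
  gs_sym : forall i j, d i j = d j i;
  gs_tri : forall i j l, d i l <= d i j + d j l;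
  gs_exp : 0 < s;
  gs_const : 0 < G;
  gs_growth : forall i r, 0 < r -> mass m (dball d i r) <= G * r `^ s }.

(** Regularity in the second variable is expressed by the same record for [transposed k]. *)
Record standard_kernel d k (A s delta : R) : Prop := StandardKernel {
  sk_const : 0 < A;
  sk_exp : 0 < delta;
  sk_size : forall i j, `|k i j| <= A / d i j `^ s;
  sk_smooth : forall i l j, d i l <= d i j / 2 ->
    `|k i j - k l j| <= A * (d i l `^ delta / d i j `^ (s + delta)) }.

Lemma powR_exprM (a r s : R) n : 0 < a -> 0 < r ->
  (a ^+ n * r) `^ s = (a `^ s) ^+ n * r `^ s.
Proof.
move=> a0 r0; elim: n => [|n IH]; first by rewrite !expr0 !mul1r.
by rewrite !exprS -!mulrA powRM ?IH // ltW // mulr_gt0 // exprn_gt0.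
Qed.

Lemma powR_monor (s x y : R) : 0 <= s -> 0 <= x -> x <= y -> x `^ s <= y `^ s.
Proof.
by move=> s0 x0 xy; rewrite ge0_ler_powR ?nnegrE // (le_trans x0).
Qed.

Lemma exists_expr_gt (a r x : R) : 2 <= a -> 0 < r ->
  exists N, x < a ^+ N * r.
Proof.
move=> a1 r0.
have := archi_boundP (normr_ge0 (x / r)); set N := Num.bound _ => h.
exists N; rewrite -ltr_pdivrMr //; apply: le_lt_trans (ler_norm _) _.
apply: lt_le_trans h _; rewrite -[leLHS]mulr1.
have : N%:R <= 2 ^+ N :> R by rewrite -natrX ler_nat ltnW // ltn_expl.
rewrite mulr1 => /le_trans; apply; apply: lerXn2r => //; rewrite ?nnegrE; lra.
Qed.

(** A point with the largest radius is selected, the points whose balls meet its ball are discarded,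
    and induction treats the others with the selected ball removed from [U]. Only centres have to be
    covered, so doubled radii suffice; as [d i i] may be positive, each centre must be assumed to
    lie in its own doubled ball. *)
Lemma vitali m d U S (rho : V -> R) (c : R) :
  (forall i, 0 <= m i) -> (forall i j, d i j = d j i) ->
  (forall i j l, d i l <= d i j + d j l) -> 0 <= c ->
  (forall i, S i -> d i i < 2 * rho i) ->
  (forall i, S i -> c * mass m (dball d i (2 * rho i))
      <= mass m [pred j | U j && dball d i (rho i) j]) ->
  c * mass m S <= mass m U.
Proof.
move=> m0 dsym dtri c0.
elim: {S}#|S| {-2}S (leqnn #|S|) U => [|n IH] S cS U Sd SU.
  rewrite (_ : mass m S = 0) ?mulr0 ?mass_ge0 //.
  apply: big_pred0 => i; apply/negbTE/negP => Si.
  by move: cS; rewrite leqn0 => /eqP /card0_eq /(_ i); rewrite unfold_in Si.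
case: (pickP S) => [i0 Si0|S0]; last first.
  by rewrite (_ : mass m S = 0) ?mulr0 ?mass_ge0 //; exact: big_pred0.
pose i := [arg max_(i > i0 | S i) rho i]%O.
have [Si imax] : S i /\ forall j, S j -> rho j <= rho i.
  by rewrite /i; case: Order.TotalTheory.arg_maxP.
pose B := dball d i (rho i).
pose S' := [pred j | [&& S j, j != i & [forall y, dball d j (rho j) y ==> ~~ B y]]].
pose U' := [pred j | U j && ~~ B j].
have h : c * mass m S' <= mass m U'.
  apply: IH.
  - rewrite -ltnS; apply: leq_trans cS; apply: proper_card.
    apply/properP; split.
      by apply/fintype.subsetP => j; rewrite !inE => /andP[].
    by exists i; rewrite // !inE eqxx andbF.
  - by move=> j /andP[/Sd].
  (* The ball of a surviving point is disjoint from [B], so removing [B] from [U] does not affect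
     its lower bound. *)
  - move=> j /and3P[Sj _ /forallP Bj]; apply: le_trans (SU _ Sj) _.
    apply: le_mass => // y /= /andP[Uy By]; rewrite Uy By andbT.
    by have := Bj y; rewrite /= By.
rewrite (mass_split m U B); apply: le_trans (lerD (SU _ Si) h).
rewrite -mulrDr ler_wpM2l //.
rewrite (mass_split m S S') addrC lerD //; last first.
  by apply: le_mass => // j /= /andP[].
apply: le_mass => // j /= /andP[Sj]; rewrite Sj /=.
have [->|/= _] := eqVneq j i; first by move=> _; exact: Sd.
rewrite negb_forall => /existsP[y]; rewrite negb_imply negbK => /andP[/= h1 h2].
have := imax _ Sj; have := dtri i y j; move: h1 h2.
rewrite (dsym y j) /B /dball /=; lra.
Qed.

(* Transporting mass [b] to the points nearest to [x] under the density cap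
   [a]: the ball around [x] is filled completely, and only the sphere
   bounding it may be filled partially. *)
Lemma fill_ball (a : V -> R) (dx : V -> R) (b : R) :
  (forall z, 0 <= a z) -> 0 <= b -> b <= \sum_z a z ->
  exists (rho : R) (psi : V -> R),
    [/\ forall z, 0 <= psi z <= 1, \sum_z psi z * a z = b,
        forall z, dx z < rho -> psi z = 1 & forall z, rho < dx z -> psi z = 0].
Proof.
move=> a0 b0 ba.
case: (pickP V) => [x0 _|V0]; last first.
  exists 0, (fun=> 0); split => [z||z|z]; try by have := V0 z.
  move: ba; rewrite !big_pred0 // => b1.
  by apply/eqP; rewrite eq_sym eq_le b1.
pose zmax := [arg max_(z > x0) dx z]%O.
have zmaxP z : dx z <= dx zmax.
  by rewrite /zmax; case: Order.TotalTheory.arg_maxP => // i _; apply.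
pose P z := b <= \sum_(y | dx y <= dx z) a y.
have Pmax : P zmax.
  by rewrite /P (eq_bigl xpredT) // => z; rewrite zmaxP.
pose z1 := [arg min_(z < zmax | P z) dx z]%O.
have [Pz1 z1min] : P z1 /\ forall z, P z -> dx z1 <= dx z.
  by rewrite /z1; case: Order.TotalTheory.arg_minP.
(* Otherwise the largest distance below [dx z1] would already satisfy [P], against minimality. *)
have inner : \sum_(y | dx y < dx z1) a y <= b.
  rewrite leNgt; apply/negP => h.
  case: (pickP [pred y | dx y < dx z1]) => [y0 /= y0z|no]; last first.
    by move: h; rewrite big_pred0 ?ltNge ?b0.
  pose z2 := [arg max_(z > y0 | dx z < dx z1) dx z]%O.
  have [z21 z2max] : dx z2 < dx z1 /\ forall z, dx z < dx z1 -> dx z <= dx z2.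
    by rewrite /z2; case: Order.TotalTheory.arg_maxP.
  suff /z1min : P z2 by rewrite leNgt z21.
  apply: le_trans (ltW h) _.
  by apply: ler_sum_pred => // y /z2max.
pose I := \sum_(y | dx y < dx z1) a y.
pose O := \sum_(y | dx y == dx z1) a y.
have IO : b <= I + O.
  move: Pz1; rewrite /P (bigID [pred y | dx y < dx z1]) /=.
  congr (_ <= _ + _); apply: eq_bigl => y; first by case: ltgtP.
  by rewrite -leNgt eq_le.
have O0 : 0 <= O by apply: sumr_ge0.
(* If the sphere has no capacity, then [I = b] and the fraction is immaterial. *)
pose lam := if O == 0 then 0 else (b - I) / O.
have lamO : lam * O = b - I.
  rewrite /lam; case: eqVneq => [zO|nzO]; last by rewrite divfK.
  move: IO; rewrite zO addr0 mul0r => h; apply/eqP; rewrite eq_sym subr_eq0.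
  by rewrite eq_le h.
have lam01 : 0 <= lam <= 1.
  rewrite /lam; case: eqVneq => [_|nzO]; first by rewrite lexx ler01.
  have O2 : 0 < O by rewrite lt_def nzO.
  rewrite divr_ge0 ?subr_ge0 //= ler_pdivrMr // mul1r; lra.
exists (dx z1), (fun z => if dx z < dx z1 then 1 else if dx z == dx z1 then lam else 0).
split => [z||z ->//|z]; last by case: ltgtP.
  by case: ltgtP; rewrite ?lexx ?ler01.
rewrite (bigID [pred y | dx y < dx z1]) /= (eq_bigr a); last first.
  by move=> y ->; rewrite mul1r.
rewrite -/I [X in I + X](_ : _ = lam * O); first by rewrite lamO; ring.
rewrite (bigID [pred y | dx y == dx z1]) /= [X in _ + X]big1 ?addr0; last first.
  by move=> y /andP[/negbTE -> /negbTE ->]; rewrite mul0r.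
rewrite /O big_distrr /=; apply: eq_big => y; first by case: ltgtP.
by move=> /andP[/negbTE -> ->].
Qed.

(* Processing the points of [s] one after the other, each of them fills
   capacity that its predecessors left free. *)
Lemma greedy_weights m d (c : V -> R) (s : seq V) :
  (forall i, 0 <= m i) -> (forall i, 0 <= c i) ->
  \sum_(x <- s) c x <= \sum_z m z -> uniq s ->
  exists (rho : V -> R) (phi : V -> V -> R),
    [/\ forall x z, 0 <= phi x z,
        forall z, \sum_(x <- s) phi x z <= 1,
        forall x, x \in s -> \sum_z phi x z * m z = c x,
        forall x z, x \in s -> d x z < rho x -> \sum_(y <- s) phi y z = 1 &
        forall x z, x \in s -> rho x < d x z -> phi x z = 0].
Proof.
move=> m0 c0; elim: s => [|x s IH] cs.
  exists (fun=> 0), (fun _ _ => 0); split => // z; by rewrite big_nil ler01.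
move=> /= /andP[xs us]; move: cs; rewrite big_cons => cs.
have [|//|rho [phi [phi0 phi1 phim phirho phiout]]] := IH.
  by apply: le_trans cs; rewrite lerDr.
pose sg z := \sum_(y <- s) phi y z.
(* The head of the list is served last, from the capacity that the tail leaves free; points
   saturated by the tail receive nothing more. *)
have [|//||r [psi [psi01 psim psi1 psi0]]] :=
    @fill_ball (fun z => (1 - sg z) * m z) (d x) (c x).
- by move=> z; rewrite mulr_ge0 // subr_ge0 phi1.
- rewrite (_ : \sum_z _ = \sum_z m z - \sum_(y <- s) c y); first lra.
  under eq_bigr do rewrite mulrBl mul1r.
  rewrite sumrB; congr (_ - _).
  under eq_bigr do rewrite /sg big_distrl /=.
  by rewrite exchange_big /=; apply: eq_big_seq => y ys; exact: phim.
pose rho' y := if y == x then r else rho y.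
pose phi' y z := if y == x then psi z * (1 - sg z) else phi y z.
have sumE z : \sum_(y <- s) phi' y z = sg z.
  apply: eq_big_seq => y ys; rewrite /phi'; case: eqP => // yx.
  by rewrite yx (negbTE xs) in ys.
have sg1 z : 0 <= 1 - sg z by rewrite subr_ge0 phi1.
exists rho', phi'; split.
- move=> y z; rewrite /phi'; case: ifP => // _.
  by rewrite mulr_ge0 //; have /andP[] := psi01 z.
- move=> z; rewrite big_cons sumE /phi' eqxx.
  have /andP[p0 p1] := psi01 z; have := sg1 z; nra.
- move=> y; rewrite inE; have [->|yx /= ys] := eqVneq y x => [_|].
    by rewrite -psim; apply: eq_bigr => z _; rewrite /phi' eqxx mulrA.
  rewrite -(phim _ ys); apply: eq_bigr => z _.
  by rewrite /phi' (negbTE yx).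
- move=> y z; rewrite inE big_cons sumE /phi' eqxx /rho'.
  have [->|yx /= ys] := eqVneq y x => [_ /psi1 ->|]; first ring.
  by move=> /(phirho _ _ ys) ; rewrite /sg => ->; ring.
- move=> y z; rewrite inE /rho' /phi'.
  have [->|yx /= ys] := eqVneq y x => [_ /psi0 ->|]; first by rewrite mul0r.
  exact: phiout.
Qed.

End GrowthSpaces.

(** * Kernel estimates and doubling radii *)

Section KernelEstimates.
Context {R : realType} {V : finType}.
Variables (m : V -> R) (d k : V -> V -> R) (A G s delta : R).
Hypothesis gs : growth_space m d G s.
Hypothesis sk : standard_kernel d k A s delta.
Implicit Types (P Q E U S : pred V) (i j : V).

Let m0 := gs_mass gs.
Let d0 := gs_pos gs.
Let s0 := gs_exp gs.
Let G0 := gs_const gs.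
Let A0 := sk_const sk.
Let delta0 := sk_exp sk.

Lemma annulus_le P i (r r' : R) : 0 < r ->
  (forall j, P j -> r <= d i j < r') ->
  \sum_(j | P j) `|k i j| * m j <= A / r `^ s * mass m (dball d i r').
Proof.
move=> r0 Pr; rewrite /mass big_distrr /=.
apply: (@le_trans _ _ (\sum_(j | P j) A / r `^ s * m j)).
  apply: ler_sum => j /Pr /andP[rd _]; apply: ler_wpM2r => //.
  apply: le_trans (sk_size sk i j) _; apply: ler_wpM2l; first exact: ltW.
  by rewrite lef_pV2 ?posrE ?powR_gt0 ?powR_monor // ltW.
apply: ler_sum_pred => [j|j /Pr /andP[]//].
by rewrite mulr_ge0 // divr_ge0 ?powR_ge0 // ltW.
Qed.

Let q : R := (2 `^ delta)^-1.

Lemma halving_ratio : 0 < q < 1.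
Proof.
have h : (1 : R) < 2 `^ delta.
  have e : 0 < delta * ln 2 by rewrite mulr_gt0 // ln_gt0 // ltr1n.
  by rewrite /powR gt_eqF // -[ltLHS]expR0 ltr_expR.
by rewrite invr_gt0 powR_gt0 //= invf_lt1 ?powR_gt0.
Qed.

Definition tail_const : R := G * 2 `^ s / (1 - q).

Lemma tail_const_gt0 : 0 < tail_const.
Proof.
have /andP[_ q1] := halving_ratio.
by rewrite divr_gt0 ?subr_gt0 // mulr_gt0 ?powR_gt0.
Qed.

(** On the annulus between [2^n r] and [2^(n+1) r] the growth condition gives at most
    [G 2^s r^-delta q^n], and these terms form a geometric series. *)
Lemma tail_le i (r : R) : 0 < r ->
  \sum_(j | r <= d i j) m j / d i j `^ (s + delta) <= tail_const / r `^ delta.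
Proof.
move=> r0; have /andP[q0 q1] := halving_ratio.
have step N : \sum_(j | r <= d i j < 2 ^+ N * r) m j / d i j `^ (s + delta)
    <= G * 2 `^ s / r `^ delta * \sum_(n < N) q ^+ n.
  elim: N => [|N IH].
    rewrite big_ord0 mulr0 expr0 mul1r big_pred0 // => j.
    by apply/negbTE; rewrite negb_and -leNgt; case: leP => // /ltW.
  rewrite big_ord_recr /= mulrDr (bigID [pred j | d i j < 2 ^+ N * r]) /=.
  set rho := 2 ^+ N * r in IH *.
  have rho0 : 0 < rho by rewrite mulr_gt0 // exprn_gt0.
  rewrite lerD //.
    apply: le_trans IH; apply: ler_sum_pred => j.
      by rewrite divr_ge0 ?powR_ge0.
    by move=> /andP[/andP[-> _] ->].
  apply: (@le_trans _ _ ((rho `^ (s + delta))^-1 * mass m (dball d i (2 * rho)))).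
    rewrite /mass big_distrr /=.
    apply: (@le_trans _ _ (\sum_(j | (r <= d i j < 2 ^+ N.+1 * r)
        && ~~ (d i j < rho)) (rho `^ (s + delta))^-1 * m j)).
      apply: ler_sum => j /andP[_]; rewrite -leNgt => h.
      rewrite mulrC ler_wpM2r // lef_pV2 ?posrE ?powR_gt0 //.
      by rewrite powR_monor // ltW // addr_gt0.
    apply: ler_sum_pred => [j|j /andP[/andP[_]]].
      by rewrite mulr_ge0 // invr_ge0 powR_ge0.
    by rewrite /rho mulrA -exprS.
  apply: (@le_trans _ _ ((rho `^ (s + delta))^-1 * (G * (2 * rho) `^ s))).
    rewrite ler_wpM2l ?invr_ge0 ?powR_ge0 //; apply: (gs_growth gs).
    by rewrite mulr_gt0.
  rewrite powRM ?(ltW rho0) // powRD; last by rewrite (gt_eqF rho0) implybT.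
  have -> : rho `^ delta = q ^- N * r `^ delta.
    by rewrite /rho powR_exprM // /q exprVn invrK.
  have := powR_gt0 s rho0; have := powR_gt0 delta r0; have : 0 < q ^+ N by rewrite exprn_gt0.
  set x := rho `^ s; set y := r `^ delta; set z := q ^+ N => z0 y0 x0.
  rewrite le_eqVlt; apply/orP; left; apply/eqP; field.
  by rewrite !gt_eqF.
have [N dN] : exists N, forall j, d i j < 2 ^+ N * r.
  have [N h] := @exists_expr_gt R 2 r (\sum_j d i j) (lexx _) r0.
  exists N => j; apply: le_lt_trans h; rewrite (bigD1 j) //= lerDl.
  by apply: sumr_ge0 => l _; exact: ltW.
have := step N; rewrite (eq_bigl [pred j | r <= d i j]); last first.
  by move=> j /=; rewrite dN andbT.
move=> /le_trans; apply.
rewrite /tail_const -mulrA [leRHS]mulrAC -!mulrA.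
rewrite ler_wpM2l ?(ltW G0) // ler_wpM2l ?powR_ge0 //.
rewrite ler_wpM2l ?invr_ge0 ?powR_ge0 //.
rewrite -[leRHS]mul1r ler_pdivlMr ?subr_gt0 //.
have -> : (\sum_(n < N) q ^+ n) * (1 - q) = 1 - q ^+ N.
  rewrite -[1 in RHS](expr1n _ N) subrXX mulrC; congr (_ * _).
  by apply: eq_bigr => n _; rewrite expr1n mul1r.
by rewrite gerBl exprn_ge0 // ltW.
Qed.

Definition far_const : R := A * tail_const.

Lemma far_const_gt0 : 0 < far_const.
Proof. by rewrite mulr_gt0 // tail_const_gt0. Qed.

(** Smoothness yields the factor [r^delta] and the tail beyond [2 r] yields [(2 r)^-delta]: the
    scale cancels, and the bound is uniform in [r]. *)
Lemma far_le P i l (r : R) : 0 < r -> d i l <= r ->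
  (forall j, P j -> 2 * r <= d i j) ->
  \sum_(j | P j) `|k i j - k l j| * m j <= far_const.
Proof.
move=> r0 il Pr.
apply: (@le_trans _ _ (\sum_(j | 2 * r <= d i j)
    A * r `^ delta * (m j / d i j `^ (s + delta)))).
  apply: (@le_trans _ _ (\sum_(j | P j)
    A * r `^ delta * (m j / d i j `^ (s + delta)))).
    apply: ler_sum => j /Pr h.
    rewrite [X in _ <= _ * X]mulrC mulrA ler_wpM2r //.
    have h2 : d i l <= d i j / 2 by lra.
    apply: le_trans (sk_smooth sk h2) _.
    rewrite -[leRHS]mulrA ler_wpM2l ?(ltW A0) // ler_wpM2r ?invr_ge0 ?powR_ge0 //.
    by rewrite powR_monor // ltW.
  apply: ler_sum_pred => // j.
  by rewrite !mulr_ge0 ?invr_ge0 ?powR_ge0 // ltW.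
rewrite -big_distrr /=.
have r20 : 0 < 2 * r by rewrite mulr_gt0.
apply: (@le_trans _ _ (A * r `^ delta * (tail_const / (2 * r) `^ delta))).
  by rewrite ler_wpM2l ?tail_le // mulr_ge0 ?powR_ge0 // ltW.
rewrite /far_const -mulrA ler_wpM2l ?(ltW A0) // mulrCA -[leRHS]mulr1.
rewrite ler_wpM2l ?(ltW tail_const_gt0) //.
rewrite ler_pdivrMr ?powR_gt0 // mul1r powR_monor ?(ltW delta0) ?(ltW r0) //; lra.
Qed.

Lemma kint_diff_le P i l (r : R) : 0 < r -> d i l <= r ->
  (forall j, P j -> 2 * r <= d i j) ->
  `|kint k m P i - kint k m P l| <= far_const.
Proof.
move=> r0 il Pr; apply: le_trans (far_le r0 il Pr).
rewrite /kint -sumrB; apply: le_trans (ler_norm_sum _ _ _) _.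
by apply: ler_sum => j _; rewrite -mulrBl normrM (ger0_norm (m0 j)).
Qed.

Lemma norm_kint_le P i : `|kint k m P i| <= \sum_(j | P j) `|k i j| * m j.
Proof.
apply: le_trans (ler_norm_sum _ _ _) _.
by apply: ler_sum => j _; rewrite normrM (ger0_norm (m0 j)).
Qed.

Definition doubling_const : R := 2 * 4 `^ s.

Local Notation Lam := doubling_const.

Lemma doubling_const_ge2 : 2 <= Lam.
Proof.
rewrite /doubling_const -[leLHS]mulr1 ler_wpM2l //.
by rewrite -[leLHS](powRr0 4) ler_powR ?(ltW s0) // ler1n.
Qed.

(* The radius maximises [mass (ball 4^n r) / Lam^n]: this makes the ball
   doubling, and the masses at smaller scales decay geometrically faster than
   the kernel grows, as [Lam > 4^s]. *)
Lemma doubling_radius i (r : R) : 0 < r -> 0 < mass m predT ->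
  exists rho, [/\ r <= rho, 0 < mass m (dball d i rho),
    mass m (dball d i (4 * rho)) <= Lam * mass m (dball d i rho) &
    \sum_(j | r <= d i j < 2 * rho) `|k i j| * m j <= 2 * A * G * Lam].
Proof.
move=> r0 M0.
have L2 := doubling_const_ge2; have L0 : 0 < Lam by lra.
pose B n := mass m (dball d i (4 ^+ n * r)).
pose a n := B n / Lam ^+ n.
have [N dN] : exists N, forall j, d i j < 4 ^+ N * r.
  have [|N h] := @exists_expr_gt R 4 r (\sum_j d i j) _ r0; first lra.
  exists N => j; apply: le_lt_trans h; rewrite (bigD1 j) //= lerDl.
  by apply: sumr_ge0 => l _; exact: ltW.
have BN n : (N <= n)%N -> B n = mass m predT.
  move=> Nn; apply: eq_bigl => j; apply: lt_le_trans (dN j) _.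
  by rewrite ler_wpM2r ?(ltW r0) // ler_weXn2l // ler1n.
(* [a] decreases once the balls contain all points, so the maximum over [n <= N] is a global one. *)
pose K := [arg max_(n > (@ord0 N)) a n]%O.
have Kmax n : a n <= a K.
  have h (x : 'I_N.+1) : a x <= a K.
    by rewrite /K; case: Order.TotalTheory.arg_maxP => // x0 _; apply.
  case: (ltnP n N.+1) => nN; first exact: (h (Ordinal nN)).
  apply: le_trans (h ord_max); rewrite /a /= !BN ?leqnn ?(ltnW nN) //.
  rewrite ler_wpM2l ?(ltW M0) // lef_pV2 ?posrE ?exprn_gt0 //.
  by rewrite ler_weXn2l ?(ltnW nN) //; lra.
have BK n : B n <= Lam ^+ n / Lam ^+ K * B K.
  have := Kmax n; rewrite /a ler_pdivrMr ?exprn_gt0 // => /le_trans; apply.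
  by rewrite le_eqVlt; apply/orP; left; apply/eqP; ring.
have BK0 : 0 < B K.
  have := BK N; rewrite BN // => /(lt_le_trans M0).
  by rewrite pmulr_rgt0 // divr_gt0 // exprn_gt0.
exists (4 ^+ K * r); split => //.
- by rewrite -[leLHS]mul1r ler_wpM2r ?(ltW r0) // exprn_ege1 // ler1n.
- rewrite mulrA -exprS; apply: le_trans (BK K.+1) _.
  by rewrite exprS mulfK // expf_neq0 // gt_eqF.
(* As [Lam / 4^s = 2], the bounds for the successive annuli double with [n]: the one at scale [n] is
   [T n / 2], and their sum stays below [T n]. *)
pose T n := 2 * A * G * Lam * (2 ^+ n / 2 ^+ K).
have term n : A / (4 ^+ n * r) `^ s * B n.+1 <= T n / 2.
  have BKG : B K <= G * (4 ^+ K * r) `^ s.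
    by apply: (gs_growth gs); rewrite mulr_gt0 // exprn_gt0.
  have pn x : 0 < (4 ^+ x * r) `^ s by rewrite powR_gt0 // mulr_gt0 // exprn_gt0.
  apply: (@le_trans _ _ (A / (4 ^+ n * r) `^ s *
      (Lam ^+ n.+1 / Lam ^+ K * (G * (4 ^+ K * r) `^ s)))).
    rewrite ler_wpM2l ?divr_ge0 ?(ltW A0) ?(ltW (pn _)) //.
    apply: le_trans (BK _) _; rewrite ler_wpM2l // ?divr_ge0 ?exprn_ge0 // ?ltW //.
  rewrite /T !powR_exprM // exprS /doubling_const.
  rewrite !exprMn.
  have : 0 < (4 `^ s) ^+ n :> R by rewrite exprn_gt0 // powR_gt0.
  have : 0 < (4 `^ s) ^+ K :> R by rewrite exprn_gt0 // powR_gt0.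
  have : 0 < (2 : R) ^+ K by rewrite exprn_gt0.
  have := powR_gt0 s r0.
  set x1 := r `^ s; set x2 := 2 ^+ K; set x3 := _ ^+ K; set x4 := (4 `^ s) ^+ n.
  move=> x10 x20 x30 x40.
  rewrite le_eqVlt; apply/orP; left; apply/eqP; field.
  by rewrite !gt_eqF.
have part n : \sum_(j | r <= d i j < 4 ^+ n.+1 * r) `|k i j| * m j <= T n.
  have T0 x : 0 <= T x.
    by rewrite /T !mulr_ge0 ?invr_ge0 ?exprn_ge0 ?powR_ge0 ?(ltW A0) ?(ltW G0).
  elim: n => [|n IH].
    apply: (@le_trans _ _ (A / (4 ^+ 0 * r) `^ s * B 1)).
      by rewrite expr0 mul1r; exact: annulus_le.
    by apply: le_trans (term 0) _; have := T0 0; lra.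
  rewrite (bigID [pred j | d i j < 4 ^+ n.+1 * r]) /=.
  have -> : T n.+1 = T n + T n.+1 / 2.
    have -> : T n.+1 = 2 * T n by rewrite /T exprS -(mulrA 2 (2 ^+ n)) mulrCA.
    lra.
  rewrite lerD //.
    apply: le_trans IH; apply: ler_sum_pred => [j|j].
      by rewrite mulr_ge0.
    by move=> /andP[/andP[-> _] ->].
  apply: le_trans (term n.+1); apply: annulus_le.
    by rewrite mulr_gt0 // exprn_gt0.
  by move=> j /andP[/andP[_ ->]]; rewrite -leNgt => ->.
have -> : 2 * A * G * Lam = T K by rewrite /T divff ?mulr1 // expf_neq0 // pnatr_eq0.
apply: le_trans (part K); apply: ler_sum_pred => [j|j].
  by rewrite mulr_ge0.
move=> /andP[-> h] /=; apply: lt_le_trans h _.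
by rewrite exprS -mulrA ler_wpM2r ?mulr_ge0 ?exprn_ge0 ?(ltW r0) //; lra.
Qed.

End KernelEstimates.

(** * The maximal truncation and the logarithmic bound *)

Section Cotlar.
Context {R : realType} {V : finType}.
Variables (m : V -> R) (d k : V -> V -> R) (A G s delta H : R).
Hypothesis gs : growth_space m d G s.
Hypothesis sk : standard_kernel d k A s delta.
Hypothesis H0 : 0 < H.
Hypothesis restricted : forall Q E : pred V,
  \sum_(i | E i) m i * `|kint k m Q i| <= H * (mass m Q + mass m E).
Implicit Types (P Q E U S : pred V) (i j : V).

Let m0 := gs_mass gs.
Let d0 := gs_pos gs.
Let dsym := gs_sym gs.
Let dtri := gs_tri gs.
Let G0 := gs_const gs.
Let A0 := sk_const sk.

Local Notation Lam := (doubling_const s).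
Local Notation Cfar := (far_const A G s delta).

Let Lam2 : 2 <= Lam.
Proof. exact: (doubling_const_ge2 gs). Qed.

Definition trunc_kint E i (r : R) : R := kint k m [pred j | E j && (r <= d i j)] i.

Definition level E (x : R) : pred V := [pred j | x < `|kint k m E j|].

(** The summands account for the kernel between the radii [r] and [2 rho], for the oscillation of
    the far part over the doubling ball, and for the threshold at which Chebyshev excludes at most
    half of that ball. *)
Definition cotlar_const : R := 2 * A * G * Lam + Cfar + 4 * H * Lam.

Lemma cotlar_const_gt0 : 0 < cotlar_const.
Proof.
have L0 : 0 < Lam by apply: lt_le_trans Lam2.
have C0 := far_const_gt0 gs sk.
by rewrite !addr_gt0 // !mulr_gt0 // ?powR_gt0.
Qed.

(* Half of the doubling ball around [i] lies in the level set: the far part of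
   the kernel is almost constant on the ball, and the near part is small on
   half of it by Chebyshev. *)
Lemma cotlar_point E i (r x : R) : 0 <= x -> 0 < r ->
  cotlar_const + x < `|trunc_kint E i r| ->
  exists rho, d i i < 2 * rho /\
    (2 * Lam)^-1 * mass m (dball d i (2 * rho))
      <= mass m [pred j | level E x j && dball d i rho j].
Proof.
move=> x0 r0 big.
have L0 : 0 < Lam by apply: lt_le_trans Lam2.
have C0 := cotlar_const_gt0.
have M0 : 0 < mass m predT.
  rewrite lt_def mass_ge0 // andbT; apply/eqP => M0.
  have mz j : m j = 0 := psumr_eq0P (fun i _ => m0 i) M0 (erefl true).
  move: big; rewrite /trunc_kint /kint big1 ?normr0; first lra.
  by move=> j _; rewrite mz mulr0.
have [rho [rrho B0 B4 near]] := doubling_radius gs sk i r0 M0.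
have rho0 : 0 < rho by apply: lt_le_trans rrho.
exists rho; split.
  (* The diagonal need not vanish, but the ball is nonempty, and the triangle inequality through one
     of its points bounds [d i i]. *)
  case: (pickP (dball d i rho)) => [j|none]; last first.
    by move: B0; rewrite /mass big_pred0 // ltxx.
  by rewrite /dball /= => dj; have := dtri i j i; rewrite (dsym j i); lra.
set B := dball d i rho in B0 B4 *; set B2 := dball d i (2 * rho).
have mB2 : mass m B2 <= Lam * mass m B.
  apply: le_trans B4; apply: le_mass => // j; rewrite /B2 /dball /=; lra.
pose D := [pred j | B j && ~~ level E x j].
have mB : mass m B = mass m [pred j | level E x j && B j] + mass m D.
  rewrite (mass_split m B (level E x)); congr (_ + _).
  by apply: eq_bigl => j; rewrite /= andbC.
suff mD : 2 * mass m D <= mass m B.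
  have L20 : 0 < 2 * Lam by lra.
  rewrite ler_pdivrMl //; apply: le_trans mB2 _.
  have h : mass m B <= 2 * mass m [pred j | level E x j && B j] by lra.
  by have := ler_wpM2l (ltW L0) h; lra.
(* Where the integral over [E] is at most [x], the far part is still almost as large as at [i]; the
   part of [E] in the doubled ball has to compensate for it, and is therefore at least [4 H Lam]. *)
have EB2 y : D y -> 4 * H * Lam <= `|kint k m [pred j | E j && B2 j] y|.
  move=> /andP[By]; rewrite /level /= -leNgt => Uy.
  have e1 := kint_split k m E B2 y.
  have e2 := kint_split k m [pred j | E j && (r <= d i j)] B2 i.
  have h1 : `|kint k m [pred j | [pred j | E j && (r <= d i j)] j && B2 j] i|
      <= 2 * A * G * Lam.
    apply: le_trans (norm_kint_le k gs _ _) _; apply: le_trans near.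
    apply: ler_sum_pred => [j|j /= /andP[/andP[_ ->]]]; last exact.
    by rewrite mulr_ge0.
  have e3 : kint k m [pred j | [pred j | E j && (r <= d i j)] j && ~~ B2 j] i
      = kint k m [pred j | E j && ~~ B2 j] i.
    apply: eq_kint => j /=; case: (E j) => //=.
    rewrite /B2 /dball /= -leNgt; case: (leP (2 * rho) _); rewrite ?andbF //.
    by move=> h; rewrite andbT; lra.
  have h2 : `|kint k m [pred j | E j && ~~ B2 j] i
            - kint k m [pred j | E j && ~~ B2 j] y| <= Cfar.
    apply: (kint_diff_le gs sk rho0); first exact: ltW.
    by move=> j /= /andP[_]; rewrite -leNgt.
  move: big; rewrite /trunc_kint e2 e3 => big.
  move: Uy; rewrite e1 => Uy.
  move: big h1 h2 Uy; rewrite /cotlar_const.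
  set a := kint _ _ _ i; set b := kint _ _ _ i; set c := kint _ _ _ y.
  set e := kint _ _ _ y => big h1 h2 Uy.
  have t1 := ler_normD a b.
  have := ler_normD (b - c) c; have := ler_normD (e + c) (- e).
  rewrite subrK addrAC subrr add0r normrN => t2 t3.
  lra.
have l1 : 4 * H * Lam * mass m D <=
    \sum_(y | D y) m y * `|kint k m [pred j | E j && B2 j] y|.
  rewrite /mass big_distrr /=; apply: ler_sum => y /EB2 h.
  by rewrite mulrC ler_wpM2l.
have l2 := restricted [pred j | E j && B2 j] D.
have l3 : mass m [pred j | E j && B2 j] <= mass m B2.
  by apply: le_mass => // j /andP[].
have l4 : mass m D <= mass m B by apply: le_mass => // j /andP[].
have l5 : 4 * H * Lam * mass m D <= H * (Lam * mass m B + mass m B).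
  by apply: le_trans l1 (le_trans l2 _); rewrite ler_wpM2l ?(ltW H0) //; lra.
have l6 : 4 * Lam * mass m D <= Lam * mass m B + mass m B.
  by rewrite -(ler_pM2l H0); apply: le_trans l5; rewrite !mulrA (mulrC H 4).
have l7 : 4 * Lam * mass m D <= 2 * Lam * mass m B.
  by have := ler_wpM2r (mass_ge0 B m0) Lam2; lra.
have l8 : 0 < 2 * Lam by lra.
rewrite -(ler_pM2l l8); lra.
Qed.

(** A superlevel set of the maximal truncation, written with a radius as witness so that no supremum
    has to be formed. *)
Definition exceptional E (x : R) : pred V :=
  [pred i | `[< exists2 r, 0 < r & cotlar_const + x < `|trunc_kint E i r| >]].

(** The covering lemma applied to the balls of [cotlar_point]. The two levels differ by an additive
    constant only, so the estimate can be summed over integer levels. *)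
Lemma mass_exceptional_le E (x : R) : 0 <= x ->
  mass m (exceptional E x) <= 2 * Lam * mass m (level E x).
Proof.
move=> x0; have L0 : 0 < 2 * Lam by have := Lam2; lra.
rewrite -ler_pdivrMl //.
have pt i : exists rho, exceptional E x i -> d i i < 2 * rho /\
    (2 * Lam)^-1 * mass m (dball d i (2 * rho))
      <= mass m [pred j | level E x j && dball d i rho j].
  case: (boolP (exceptional E x i)) => [/asboolP[r r0 /(cotlar_point x0 r0)]|_].
    by move=> [rho h]; exists rho.
  by exists 0.
have [rho rhoP] := choice pt.
apply: (vitali (rho := rho) m0 dsym dtri).
- by rewrite invr_ge0 ltW.
- by move=> i /rhoP[].
- by move=> i /rhoP[].
Qed.

(** With the next lemma, a discrete layer cake formula: counting the integers below [v] recovers [v]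
    up to an error of at most 1. *)
Lemma le_count_lt (v : R) (N : nat) : v <= N%:R ->
  v <= \sum_(n < N) (n%:R < v)%R%:R.
Proof.
elim: N v => [|N IH] v; first by rewrite big_ord0.
rewrite big_ord_recr /=; case: (leP v N%:R) => [vN _|Nv vN1].
  by rewrite addr0; exact: IH.
rewrite (eq_bigr (fun=> 1)) => [|n _]; last first.
  by rewrite (le_lt_trans _ Nv) // ler_nat ltnW.
by rewrite sumr_const card_ord natr1.
Qed.

Lemma count_lt_le (v : R) (N : nat) : 0 <= v ->
  \sum_(n < N) (n%:R < v)%R%:R <= v + 1.
Proof.
move=> v0; elim: N => [|N IH]; first by rewrite big_ord0; lra.
rewrite big_ord_recr /=; case: ltP => [Nv|_]; last by rewrite addr0.
rewrite lerD2r; apply: le_trans (ltW Nv).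
have -> : N%:R = \sum_(n < N) 1 :> R by rewrite sumr_const card_ord.
by apply: ler_sum => n _; case: ltP.
Qed.

Definition maximal_const : R := cotlar_const + 2 * H + 1.

Definition weight_const : R := 4 * H * Lam.

(* [w] is the excess of the maximal truncation over a constant, estimated by
   its distribution function. *)
Lemma maximal_truncation E : exists w : V -> R,
  [/\ forall i, 0 <= w i, \sum_i m i * w i <= weight_const * mass m E &
      forall i r, 0 < r -> `|trunc_kint E i r| <= maximal_const + w i].
Proof.
have L0 : 0 < Lam by apply: lt_le_trans Lam2.
(* The part [2 H] allows [H * mass m F] to be absorbed below, so that [F] has at most the mass of
   [E]; the additional 1 pays for the rounding in the layer cake formula. *)
pose L := 2 * H + 1; have L1 : 1 <= L by rewrite /L; have := H0; lra.
have [N bdd] : exists N : nat, forall i r, `|trunc_kint E i r| <= N%:R.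
  exists (Num.bound (\sum_i \sum_j `|k i j| * m j)) => i r.
  apply: le_trans (norm_kint_le k gs _ _) _.
  have nn a b : 0 <= `|k a b| * m b by rewrite mulr_ge0.
  have h0 : 0 <= \sum_i \sum_j `|k i j| * m j.
    by apply: sumr_ge0 => a _; apply: sumr_ge0.
  apply: le_trans (ltW (archi_boundP h0)).
  rewrite [leRHS](bigD1 i) //=.
  apply: (@le_trans _ _ (\sum_j `|k i j| * m j)); first exact: ler_sum_pred.
  by rewrite lerDl; apply: sumr_ge0 => a _; apply: sumr_ge0.
pose w i := \sum_(n < N) (exceptional E (L + n%:R) i)%:R : R.
have Ln n : 0 <= L + n%:R by rewrite addr_ge0 //; lra.
exists w; split.
- by move=> i; apply: sumr_ge0 => n _; rewrite ler0n.
- have -> : \sum_i m i * w i = \sum_(n < N) mass m (exceptional E (L + n%:R)).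
    under eq_bigr do rewrite big_distrr /=.
    rewrite exchange_big /=; apply: eq_bigr => n _.
    rewrite /mass [RHS]big_mkcond /=; apply: eq_bigr => i _.
    by case: ifP => _; rewrite ?mulr1 ?mulr0.
  pose F := level E L.
  have mF : mass m F <= mass m E.
    have h1 : L * mass m F <= \sum_(i | F i) m i * `|kint k m E i|.
      rewrite /mass big_distrr /=; apply: ler_sum => i Fi.
      by rewrite mulrC ler_wpM2l // ltW.
    have := le_trans h1 (restricted E F).
    have := mass_ge0 F m0; have := mass_ge0 E m0.
    set a := mass m E; set b := mass m F => a0 b0 h.
    have : (H + 1) * b <= H * a by rewrite /L in h; lra.
    have := H0; nra.
  apply: (@le_trans _ _ (2 * Lam * \sum_(i | F i) m i * `|kint k m E i|)).
    apply: (@le_trans _ _ (\sum_(n < N) 2 * Lam * mass m (level E (L + n%:R)))).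
      by apply: ler_sum => n _; exact: mass_exceptional_le.
    rewrite -big_distrr /= ler_wpM2l //; first lra.
    rewrite /mass; under eq_bigr do rewrite big_mkcond /=.
    rewrite exchange_big /= [leRHS]big_mkcond /=; apply: ler_sum => i _.
    rewrite /F /level /=; case: ltP => Fi; last first.
      by rewrite big1 // => n _; rewrite ltNge (le_trans Fi) // lerDl ler0n.
    apply: (@le_trans _ _ (\sum_(n < N) m i * (n%:R < `|kint k m E i| - L)%R%:R)).
      apply: ler_sum => n _; rewrite ltrBrDl; case: ifP => _.
        by rewrite mulr1.
      by rewrite mulr0.
    rewrite -big_distrr /= ler_wpM2l //; apply: le_trans (count_lt_le _ _) _.
      by rewrite subr_ge0 ltW.
    by rewrite -addrA gerDl; lra.
  have -> : weight_const * mass m E = 2 * Lam * (H * (mass m E + mass m E)).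
    by rewrite /weight_const; ring.
  rewrite ler_wpM2l //; first lra.
  apply: le_trans (restricted E F) _; rewrite ler_wpM2l ?(ltW H0) //; lra.
- move=> i r r0; have := bdd i r.
  set v := `|trunc_kint E i r| => vN.
  have C0 := cotlar_const_gt0.
  have h : v - cotlar_const - L <= w i.
    apply: le_trans (@le_count_lt _ N _) _; first by lra.
    apply: ler_sum => n _; rewrite ler_nat; case: ltP => //= h.
    suff -> : exceptional E (L + n%:R) i by [].
    by apply/asboolP; exists r => //; rewrite -/v; lra.
  rewrite /maximal_const; move: h; rewrite /L; lra.
Qed.

(** Origin of the terms, for a point whose mass was spread up to radius [rho] and a point [z] that
    received some of it: the points of [E] between [rho] and [2 rho] from the former, those between
    [rho] and [3 rho] from [z], the change of the far part, and the maximal truncation at [z]. *)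
Definition spread_const : R :=
  A * G * 2 `^ s + A * G * 3 `^ s + Cfar + maximal_const.

Lemma weight_const_ge0 : 0 <= weight_const.
Proof. by rewrite /weight_const !mulr_ge0 ?powR_ge0 // ltW. Qed.

Lemma spread_const_gt0 : 0 < spread_const.
Proof.
rewrite /spread_const /maximal_const; have := far_const_gt0 gs sk.
have AG x : 0 <= A * G * x `^ s by rewrite !mulr_ge0 ?powR_ge0 // ltW.
have := AG 2; have := AG 3; have := cotlar_const_gt0; have := H0; lra.
Qed.

(* The mass of [Q] is spread over [G0] with density at most [t]: as [E] avoids
   [G0], it is away from each point of [Q] at the scale on which the mass of
   that point has been spread. *)
Lemma spread Q (t : R) : 0 < t -> exists G0 : pred V,
  t * mass m G0 <= mass m Q /\
  forall E, (forall i, E i -> ~~ G0 i) ->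
    \sum_(i | Q i) m i * `|kint k m E i|
      <= spread_const * mass m Q + t * weight_const * mass m E.
Proof.
move=> t0.
have S0 := spread_const_gt0; have W0 := weight_const_ge0.
(* If the mass of [Q] does not fit under the density [t], the whole space counts as filled and [E]
   is empty. *)
case: (leP (mass m Q) (t * mass m predT)) => [small|big]; last first.
  exists predT; split; first exact: ltW.
  move=> E E0; rewrite big1 => [|i _].
    by rewrite addr_ge0 // mulr_ge0 ?mass_ge0 ?(ltW S0) // mulr_ge0 // ltW.
  rewrite /kint big_pred0 ?normr0 ?mulr0 // => j.
  by apply/negbTE/negP => /E0.
(* The demand [m i / t] turns the density cap [t] into the cap 1 on the weights. *)
have [//|||rho [phi [phi0 phi1 phim phirho phiout]]] :=
  @greedy_weights R V m d (fun i => m i / t) (enum Q) m0.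
- by move=> i; rewrite divr_ge0 // ltW.
- rewrite big_enum -mulr_suml ler_pdivrMr // mulrC.
  exact: small.
- exact: enum_uniq.
have inQ x : (x \in enum Q) = Q x by rewrite mem_enum.
have sumQ (F : V -> R) : \sum_(x <- enum Q) F x = \sum_(x | Q x) F x.
  by rewrite big_enum.
pose sg z := \sum_(x | Q x) phi x z.
have sg01 z : 0 <= sg z <= 1.
  by rewrite /sg -sumQ phi1 andbT; apply: sumr_ge0.
have tot (F : V -> R) x : Q x -> m x * F x = t * \sum_z phi x z * m z * F x.
  move=> Qx; rewrite -mulr_suml phim ?inQ // mulrA mulrCA divff ?mulr1 //.
  by rewrite gt_eqF.
exists [pred z | sg z == 1]; split.
  have -> : mass m Q = t * \sum_(x | Q x) \sum_z phi x z * m z.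
    rewrite big_distrr /=; apply: eq_bigr => x Qx.
    have := tot (fun=> 1) x Qx; rewrite mulr1 => ->.
    by congr (_ * _); apply: eq_bigr => z _; rewrite mulr1.
  rewrite ler_wpM2l ?(ltW t0) // exchange_big /= /mass big_mkcond /=.
  apply: ler_sum => z _; rewrite -big_distrl /= -/(sg z).
  case: eqP => [->|_]; first by rewrite mul1r.
  by rewrite mulr_ge0 //; have /andP[] := sg01 z.
move=> E avoid.
have [w [w0 wm wmax]] := maximal_truncation E.
have key x z : Q x -> phi x z != 0 -> `|kint k m E x| <= spread_const + w z.
  move=> Qx pxz.
  have xz : d x z <= rho x.
    by rewrite leNgt; apply: contra pxz => h; rewrite phiout ?inQ.
  have rho0 : 0 < rho x by apply: lt_le_trans xz.
  (* Every point closer to [x] than [rho x] is saturated, hence outside [E]. *)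
  have off y : E y -> rho x <= d x y.
    move=> /avoid /= sy; rewrite leNgt; apply: contra sy => h.
    by rewrite /sg -sumQ (phirho x) ?inQ.
  have grow c : 0 < c ->
      A / rho x `^ s * mass m (dball d x (c * rho x)) <= A * G * c `^ s /\
      A / rho x `^ s * mass m (dball d z (c * rho x)) <= A * G * c `^ s.
    move=> c0.
    have e : A * G * c `^ s = A / rho x `^ s * (G * (c * rho x) `^ s).
      rewrite powRM ?(ltW c0) ?(ltW rho0) //; field.
      by rewrite gt_eqF // powR_gt0.
    have cr : 0 < c * rho x by rewrite mulr_gt0.
    by split; rewrite e ler_wpM2l ?(gs_growth gs) // divr_ge0 ?powR_ge0 // ltW.
  (* On [Fx] the value at [x] may be exchanged for the value at [z], and all its points are at
     distance at least [rho x] from [z], so the truncation at [z] with this radius keeps them. *)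
  pose Fx := [pred y | 2 * rho x <= d x y].
  have h1 : `|kint k m [pred y | E y && ~~ Fx y] x| <= A * G * 2 `^ s.
    have [g _] := grow 2 (ltr0n _ _); apply: le_trans g.
    apply: le_trans (norm_kint_le k gs _ _) _.
    apply: (annulus_le gs sk) => // j /andP[/off -> /=].
    by rewrite -ltNge.
  have h2 : `|kint k m [pred y | E y && Fx y] x
            - kint k m [pred y | E y && Fx y] z| <= Cfar.
    by apply: (kint_diff_le gs sk rho0 xz) => j /andP[].
  have h3 := wmax z _ rho0.
  have e3 := kint_split k m [pred y | E y && (rho x <= d z y)] Fx z.
  have e4 : kint k m [pred y | [pred y | E y && (rho x <= d z y)] y && Fx y] z
      = kint k m [pred y | E y && Fx y] z.
    apply: eq_kint => y /=; case: (E y) => //=.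
    case: (leP (2 * rho x)) => h; rewrite ?andbF ?andbT //.
    have := dtri x z y; lra.
  have h5 : `|kint k m [pred y | [pred y | E y && (rho x <= d z y)] y
      && ~~ Fx y] z| <= A * G * 3 `^ s.
    have [_ g] := grow 3 (ltr0n _ _); apply: le_trans g.
    apply: le_trans (norm_kint_le k gs _ _) _.
    apply: (annulus_le gs sk) => // y /andP[/andP[_ ->]] /=.
    by rewrite -ltNge => h; have := dtri z x y; rewrite (dsym z x); lra.
  move: h1 h2 h3 h5; rewrite (kint_split k m E Fx x) /trunc_kint e3 e4.
  rewrite /spread_const.
  set a := kint _ _ _ x; set b := kint _ _ _ z; set c := kint _ _ _ x.
  set e := kint _ _ _ z => h1 h2 h3 h5.
  have t1 := ler_normD c a.
  have := ler_normD (c - b) b; have := ler_normD (b + e) (- e).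
  rewrite subrK addrK normrN => t2 t3.
  lra.
apply: (@le_trans _ _ (\sum_(x | Q x) t * \sum_z phi x z * m z * (spread_const + w z))).
  apply: ler_sum => x Qx; rewrite (tot (fun x => `|kint k m E x|)) //.
  rewrite ler_wpM2l ?(ltW t0) //; apply: ler_sum => z _.
  have [->|pz] := eqVneq (phi x z) 0; first by rewrite !mul0r.
  by rewrite ler_wpM2l ?key // mulr_ge0.
have -> : \sum_(x | Q x) t * \sum_z phi x z * m z * (spread_const + w z)
    = spread_const * mass m Q + t * \sum_z sg z * (m z * w z).
  rewrite /mass big_distrr /= /sg.
  under [X in t * X]eq_bigr do rewrite big_distrl /=.
  rewrite exchange_big /= big_distrr -big_split /=; apply: eq_bigr => x Qx.
  rewrite (mulrC spread_const) (tot (fun=> spread_const)) // -mulrDr.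
  congr (_ * _); rewrite -big_split /=; apply: eq_bigr => z _; ring.
rewrite lerD2l -mulrA ler_wpM2l ?(ltW t0) //.
apply: le_trans wm; apply: ler_sum => z _.
by rewrite ler_piMl ?mulr_ge0 //; have /andP[] := sg01 z.
Qed.

Definition log_const : R := spread_const + 2 * weight_const + 2 * H.

Lemma log_const_gt0 : 0 < log_const.
Proof.
rewrite /log_const; have := spread_const_gt0; have := weight_const_ge0.
by have := H0; lra.
Qed.

Lemma log_restricted Q E (n : nat) :
  \sum_(i | Q i) m i * `|kint k m E i|
    <= log_const * (n.+1%:R * mass m Q + 2 ^- n * mass m E).
Proof.
have S0 := spread_const_gt0; have W0 := weight_const_ge0.
have split E' P : \sum_(i | Q i) m i * `|kint k m E' i| <=
    \sum_(i | Q i) m i * `|kint k m [pred j | E' j && P j] i| +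
    \sum_(i | Q i) m i * `|kint k m [pred j | E' j && ~~ P j] i|.
  rewrite -big_split /=; apply: ler_sum => i _.
  by rewrite -mulrDr ler_wpM2l // (kint_split k m E' P i) ler_normD.
have Q0 := mass_ge0 Q m0.
have sub E' P : mass m [pred j | E' j && P j] <= mass m P.
  by apply: le_mass => // j /andP[].
have subl E' P : mass m [pred j | E' j && ~~ P j] <= mass m E'.
  by apply: le_mass => // j /andP[].
have p2 (j : nat) : 0 < 2 ^+ j :> R by rewrite exprn_gt0.
(* At density [2^-j], a set of mass at most [2^(j+1)] times that of [Q] costs a constant multiple of
   the mass of [Q] off the filled set, and its part in the filled set has mass at most [2^j] times
   that of [Q]: each halving is paid once. *)
have comparable (j : nat) E' : mass m E' <= 2 ^+ j * mass m Q ->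
    \sum_(i | Q i) m i * `|kint k m E' i|
      <= ((spread_const + 2 * weight_const) * j%:R + 2 * H) * mass m Q.
  elim: j E' => [|j IH] E' mE.
    apply: le_trans (restricted _ _) _; rewrite mulr0 add0r.
    move: mE; rewrite expr0 mul1r => mE; have := H0; nra.
  have tj : 0 < 2 ^- j :> R by rewrite invr_gt0.
  have [P [mP avoid]] := spread Q tj.
  apply: le_trans (split E' P) _.
  have h1 := IH [pred i | E' i && P i]; have h2 := avoid [pred i | E' i && ~~ P i].
  have {}h1 : \sum_(i | Q i) m i * `|kint k m [pred i | E' i && P i] i|
      <= ((spread_const + 2 * weight_const) * j%:R + 2 * H) * mass m Q.
    apply: h1; apply: le_trans (sub _ _) _.
    by rewrite -ler_pdivrMl.
  have {}h2 : \sum_(i | Q i) m i * `|kint k m [pred j | E' j && ~~ P j] i|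
      <= (spread_const + 2 * weight_const) * mass m Q.
    apply: le_trans (h2 _) _; first by move=> i /andP[].
    have h : 2 ^- j * mass m [pred i | E' i && ~~ P i] <= 2 * mass m Q.
      rewrite ler_pdivrMl //; apply: le_trans (subl _ _) _.
      by apply: le_trans mE _; rewrite exprS; lra.
    by have := ler_wpM2l W0 h; lra.
  by rewrite -natr1; lra.
have tn : 0 < 2 ^- n :> R by rewrite invr_gt0.
have [P [mP avoid]] := spread Q tn.
apply: le_trans (split E P) _.
have h1 : \sum_(i | Q i) m i * `|kint k m [pred i | E i && P i] i|
    <= ((spread_const + 2 * weight_const) * n%:R + 2 * H) * mass m Q.
  apply: comparable; apply: le_trans (sub _ _) _.
  by rewrite -ler_pdivrMl.
have /avoid h2 : forall i, [pred i | E i && ~~ P i] i -> ~~ P i.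
  by move=> i /andP[].
have h3 : 2 ^- n * weight_const * mass m [pred i | E i && ~~ P i]
    <= weight_const * (2 ^- n * mass m E).
  by rewrite -mulrA mulrCA ler_wpM2l // ler_wpM2l ?(ltW tn).
apply: le_trans (lerD h1 (le_trans h2 (lerD (lexx _) h3))) _.
rewrite /log_const -natr1.
have nn : 0 <= n%:R :> R by rewrite ler0n.
have e0 : 0 <= 2 ^- n * mass m E by rewrite mulr_ge0 ?mass_ge0 // ltW.
have a1 : 0 <= n%:R * mass m Q by rewrite mulr_ge0.
set c := 2 ^- n * mass m E in e0 *; set a := mass m Q in Q0 a1 *.
have := H0 => H1.
have z1 : 0 <= H * (n%:R * a) by rewrite mulr_ge0 // ltW.
have z2 : 0 <= spread_const * c by rewrite mulr_ge0 // ltW.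
have z3 : 0 <= weight_const * c by rewrite mulr_ge0.
have z4 : 0 <= H * c by rewrite mulr_ge0 // ltW.
have z5 : 0 <= weight_const * a by rewrite mulr_ge0.
lra.
Qed.

End Cotlar.

(** * Interpolation *)

Section QuadraticBounds.
Context {R : realType} {V : finType}.
Variable m : V -> R.
Hypothesis m0 : forall i, 0 <= m i.
Implicit Types (k : V -> V -> R) (f g h : V -> R) (P Q E : pred V).

Definition kapply k f i : R := \sum_j k i j * m j * f j.

Definition bform k f g : R := \sum_i m i * g i * kapply k f i.

Definition sqnorm f : R := \sum_i m i * f i ^+ 2.

Lemma sqnorm_ge0 f : 0 <= sqnorm f.
Proof. by apply: sumr_ge0 => i _; rewrite mulr_ge0 // sqr_ge0. Qed.

Lemma bform_transposed k f g : bform (transposed k) f g = bform k g f.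
Proof.
rewrite /bform /kapply.
under eq_bigr do rewrite big_distrr.
rewrite exchange_big /=; apply: eq_bigr => j _.
by rewrite big_distrr /=; apply: eq_bigr => i _; rewrite /transposed; ring.
Qed.

Lemma kapplyZ k c f i : kapply k (fun j => c * f j) i = c * kapply k f i.
Proof. by rewrite /kapply big_distrr; apply: eq_bigr => j _; rewrite mulrCA. Qed.

Lemma bformZ k a b f g :
  bform k (fun i => a * f i) (fun i => b * g i) = a * b * bform k f g.
Proof.
by rewrite /bform big_distrr; apply: eq_bigr => i _; rewrite kapplyZ /=; ring.
Qed.

Lemma sqnormZ a f : sqnorm (fun i => a * f i) = a ^+ 2 * sqnorm f.
Proof. by rewrite /sqnorm big_distrr; apply: eq_bigr => i _ /=; ring. Qed.

(** The choice [g = kapply k f / (2 C)] puts half of the left-hand side on the right, where it is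
    absorbed. *)
Lemma sqnorm_kapply_le k (C : R) f : 0 < C ->
  (forall g, `|bform k f g| <= C * (sqnorm f + sqnorm g)) ->
  sqnorm (kapply k f) <= 4 * C ^+ 2 * sqnorm f.
Proof.
move=> C0 B.
have := B (fun i => (2 * C)^-1 * kapply k f i); rewrite sqnormZ.
have -> : bform k f (fun i => (2 * C)^-1 * kapply k f i)
    = (2 * C)^-1 * sqnorm (kapply k f).
  by rewrite /bform /sqnorm big_distrr; apply: eq_bigr => i _ /=; ring.
set X := sqnorm (kapply k f); set F := sqnorm f.
have X0 : 0 <= X by exact: sqnorm_ge0.
rewrite ger0_norm ?mulr_ge0 ?invr_ge0 ?mulr_ge0 ?(ltW C0) //.
rewrite ler_pdivrMl ?mulr_gt0 // => h.
have e : 2 * C * (C * (F + (2 * C)^-1 ^+ 2 * X)) = 2 * C ^+ 2 * F + X / 2.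
  by field; rewrite gt_eqF.
rewrite e in h; lra.
Qed.

(** Used for the discretization error, whose kernel is positive and offers no cancellation. *)
Lemma schur_bound k (S : R) f g : 0 <= S -> (forall i j, 0 <= k i j) ->
  (forall i j, k i j = k j i) -> (forall i, \sum_j k i j * m j <= S) ->
  `|bform k f g| <= S * (sqnorm f + sqnorm g).
Proof.
move=> S0 k0 ks kS.
have row h : \sum_i \sum_j k i j * m i * m j * h i ^+ 2 <= S * sqnorm h.
  rewrite /sqnorm big_distrr; apply: ler_sum => i _ /=.
  have -> : \sum_j k i j * m i * m j * h i ^+ 2
      = (\sum_j k i j * m j) * (m i * h i ^+ 2).
    by rewrite big_distrl; apply: eq_bigr => j _ /=; ring.
  by rewrite ler_wpM2r // mulr_ge0 // sqr_ge0.
apply: (@le_trans _ _ (\sum_i \sum_j (k i j * m i * m j * g i ^+ 2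
    + k i j * m i * m j * f j ^+ 2))).
  apply: le_trans (ler_norm_sum _ _ _) _; apply: ler_sum => i _.
  rewrite /kapply big_distrr; apply: le_trans (ler_norm_sum _ _ _) _.
  apply: ler_sum => j _ /=; rewrite -mulrDr.
  have -> : m i * g i * (k i j * m j * f j) = k i j * m i * m j * (g i * f j).
    by ring.
  have p : 0 <= k i j * m i * m j by rewrite !mulr_ge0.
  rewrite normrM (ger0_norm p) ler_wpM2l // ler_norml.
  have := sqr_ge0 (g i + f j); have := sqr_ge0 (g i - f j).
  have := sqr_ge0 (g i); have := sqr_ge0 (f j).
  by rewrite !expr2 => *; apply/andP; split; lra.
under eq_bigr do rewrite big_split /=.
rewrite big_split /= mulrDr addrC lerD //.
rewrite exchange_big /=; apply: le_trans (row f).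
apply: ler_sum => i _; apply: ler_sum => j _; rewrite le_eqVlt; apply/orP; left.
by apply/eqP; rewrite (ks j i); ring.
Qed.

(* A linear functional attains its maximum over [0, 1]-valued functions at a
   characteristic function. *)
Lemma bform_unit_le k (L : R) Q E f g (n : nat) : 0 <= L ->
  (forall E', \sum_(i | Q i) m i * `|kint (transposed k) m E' i|
     <= L * (n.+1%:R * mass m Q + 2 ^- n * mass m E')) ->
  (forall i, 0 <= f i <= (Q i)%:R) -> (forall i, 0 <= g i <= (E i)%:R) ->
  `|bform k f g| <= 2 * L * (n.+1%:R * mass m Q + 2 ^- n * mass m E).
Proof.
move=> L0 log fQ gE.
have n0 : 0 < 2 ^- n :> R by rewrite invr_gt0 exprn_gt0.
pose b := L * (n.+1%:R * mass m Q + 2 ^- n * mass m E).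
have sub E' : (forall i, E' i -> E i) ->
    `|\sum_(i | E' i) m i * kapply k f i| <= b.
  move=> E'E.
  have -> : \sum_(i | E' i) m i * kapply k f i
      = \sum_j m j * f j * kint (transposed k) m E' j.
    rewrite /kapply /kint; under eq_bigr do rewrite big_distrr.
    rewrite exchange_big /=; apply: eq_bigr => j _.
    by rewrite big_distrr /=; apply: eq_bigr => i _; rewrite /transposed; ring.
  apply: le_trans (ler_norm_sum _ _ _) _.
  apply: (@le_trans _ _ (\sum_(i | Q i) m i * `|kint (transposed k) m E' i|)).
    rewrite [leRHS]big_mkcond /=; apply: ler_sum => i _.
    have /andP[f0] := fQ i; case: (Q i) => f1.
      rewrite !normrM (ger0_norm (m0 i)) (ger0_norm f0) -mulrA ler_wpM2l //.
      by rewrite ler_piMl.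
    have -> : f i = 0 by apply/eqP; rewrite eq_le f0 f1.
    by rewrite mulr0 mul0r normr0.
  apply: le_trans (log E') _; rewrite ler_wpM2l // lerD2l ler_wpM2l ?(ltW n0) //.
  exact: le_mass.
pose T := [pred i | 0 <= kapply k f i].
have bnd : `|bform k f g| <= \sum_(i | E i) m i * `|kapply k f i|.
  apply: le_trans (ler_norm_sum _ _ _) _.
  rewrite [leRHS]big_mkcond /=; apply: ler_sum => i _.
  have /andP[g0] := gE i; case: (E i) => g1.
    rewrite !normrM (ger0_norm (m0 i)) (ger0_norm g0) -mulrA ler_wpM2l //.
    by rewrite ler_piMl.
  have -> : g i = 0 by apply/eqP; rewrite eq_le g0 g1.
  by rewrite mulr0 mul0r normr0.
apply: le_trans bnd _; rewrite (bigID T) /=.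
have h1 : `|\sum_(i | E i && T i) m i * kapply k f i| <= b.
  by apply: sub => i /andP[].
have h2 : `|\sum_(i | E i && ~~ T i) m i * kapply k f i| <= b.
  by apply: sub => i /andP[].
rewrite (eq_bigr (fun i => m i * kapply k f i)); last first.
  by move=> i /andP[_ h]; rewrite ger0_norm.
rewrite [X in _ + X](eq_bigr (fun i => - (m i * kapply k f i))); last first.
  by move=> i /andP[_]; rewrite /T /= -ltNge => h; rewrite ltr0_norm // mulrN.
rewrite sumrN; rewrite -/b in h1 h2 *.
move: h1 h2; rewrite !ler_norml => /andP[_ h1] /andP[h2 _].
rewrite -mulrA -/b; lra.
Qed.

Lemma dyadic_level (v : R) : 1 <= v -> exists n : nat, 2 ^+ n <= v < 2 ^+ n.+1.
Proof.
move=> v1.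
have [N hN] := @exists_expr_gt R 2 1 v (lexx _) ltr01; rewrite mulr1 in hN.
have ex : exists n, (fun n => v < 2 ^+ n) n by exists N.
case: (ex_minnP ex) => -[|n] vn nmin; first by rewrite expr0 ltNge v1 in vn.
exists n; rewrite vn andbT leNgt; apply/negP => /nmin.
by rewrite ltnn.
Qed.

(** The weight of two levels [n] apart: the logarithmic loss at [2 n], divided by the ratio [2^n] of
    the levels. *)
Definition dyadic_coef (n : nat) : R := (n.*2.+1)%:R / 2 ^+ n.

(** Subtraction is truncated, so [(a - b) + (b - a)] is the distance between [a] and [b]. *)
Lemma dyadic_coef_sum (a N : nat) :
  \sum_(b < N) dyadic_coef ((a - b) + (b - a)) <= 12.
Proof.
(* [u] is a discrete primitive of [- dyadic_coef], which makes the sums telescope; as [u 0 = 6],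
   each side of [a] contributes at most 6. *)
pose u n : R := (4 * n%:R + 6) / 2 ^+ n.
have ucoef n : dyadic_coef n = u n - u n.+1.
  have e : (2 : R) ^+ n != 0 by rewrite expf_neq0 // pnatr_eq0.
  have e1 : n.*2.+1%:R = 2 * n%:R + 1 :> R by rewrite -natr1 -mul2n natrM.
  have e2 : n.+1%:R = n%:R + 1 :> R by rewrite natr1.
  rewrite /dyadic_coef /u e1 e2 exprS.
  set x := (2 : R) ^+ n in e *; field.
  by rewrite e.
have u0 n : 0 <= u n by rewrite divr_ge0 ?exprn_ge0 // addr_ge0 // mulr_ge0.
have below b : (b <= a)%N ->
    \sum_(c < b) dyadic_coef ((a - c) + (c - a)) <= u (a - b).+1.
  elim: b => [|b IH] ba; first by rewrite big_ord0.
  rewrite big_ord_recr /=; apply: le_trans (lerD (IH (ltnW ba)) (lexx _)) _.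
  have -> : (b - a = 0)%N by apply/eqP; rewrite subn_eq0 ltnW.
  by rewrite addn0 ucoef subnSK // addrC subrK.
have above b : \sum_(c < a + b) dyadic_coef ((a - c) + (c - a)) <= 12 - u b.
  elim: b => [|b IH].
    rewrite addn0; apply: le_trans (below _ (leqnn _)) _.
    by rewrite subnn /u expr1 expr0; lra.
  rewrite addnS big_ord_recr /=; apply: le_trans (lerD IH (lexx _)) _.
  have -> : (a - (a + b) = 0)%N by apply/eqP; rewrite subn_eq0 leq_addr.
  rewrite add0n addKn ucoef; lra.
case: (leqP N a) => Na.
  apply: le_trans (below N Na) _.
  suff h n : u n <= 6 by have := h (a - N).+1; lra.
  elim: n => [|n IH]; first by rewrite /u expr0; lra.
  have : 0 <= dyadic_coef n by rewrite divr_ge0 // exprn_ge0.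
  rewrite ucoef; lra.
rewrite -(subnKC (ltnW Na)); apply: le_trans (above _) _.
by rewrite gerBl.
Qed.

End QuadraticBounds.

Section Interpolation.
Context {R : realType} {V : finType}.
Variable m : V -> R.
Hypothesis m0 : forall i, 0 <= m i.
Implicit Types (k : V -> V -> R) (f g h : V -> R) (P Q E F : pred V).

Definition log_bounded k (L : R) := forall Q E (n : nat),
  \sum_(i | Q i) m i * `|kint k m E i|
    <= L * (n.+1%:R * mass m Q + 2 ^- n * mass m E).

(** With [n = a - b], the factor [2^(a+b)] is both [4^a / 2^n] and [4^b * 2^n]. The logarithmic
    bound at [2 n] supplies [4^-n] in front of the mass of [E], so that both terms gain [2^-n]. *)
Lemma level_term k (L : R) F E f g (a b : nat) : 0 <= L ->
  log_bounded (transposed k) L -> (b <= a)%N ->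
  (forall i, 0 <= f i <= 2 ^+ a.+1 * (F i)%:R) ->
  (forall i, 0 <= g i <= 2 ^+ b.+1 * (E i)%:R) ->
  `|bform m k f g| <= 8 * L * (dyadic_coef (a - b) *
     (4 ^+ a * mass m F + 4 ^+ b * mass m E)).
Proof.
move=> L0 log ba fF gE.
have p2 n : 0 < (2 : R) ^+ n by rewrite exprn_gt0.
pose f' i := (2 ^+ a.+1)^-1 * f i; pose g' i := (2 ^+ b.+1)^-1 * g i.
have h := @bform_unit_le R V m m0 k L F E f' g' (a - b).*2 L0
  (fun E' => log F E' (a - b).*2).
have -> : bform m k f g = 2 ^+ a.+1 * 2 ^+ b.+1 * bform m k f' g'.
  by rewrite bformZ; field; rewrite !gt_eqF.
rewrite normrM ger0_norm; last by rewrite mulr_ge0 // ltW.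
have {}h : `|bform m k f' g'| <= 2 * L *
    ((a - b).*2.+1%:R * mass m F + 2 ^- (a - b).*2 * mass m E).
  apply: h => i.
    have /andP[f0 f1] := fF i.
    by rewrite mulr_ge0 ?invr_ge0 ?(ltW (p2 _)) //= ler_pdivrMl.
  have /andP[g0 g1] := gE i.
  by rewrite mulr_ge0 ?invr_ge0 ?(ltW (p2 _)) //= ler_pdivrMl.
apply: le_trans (ler_wpM2l _ h) _; first by rewrite mulr_ge0 // ltW.
have four n : (4 : R) ^+ n = 2 ^+ n * 2 ^+ n.
  by rewrite -exprMn; congr (_ ^+ _); ring.
rewrite !four /dyadic_coef !exprS.
have -> : (2 : R) ^+ a = 2 ^+ b * 2 ^+ (a - b) by rewrite -exprD subnKC.
have -> : (2 : R) ^+ (a - b).*2 = 2 ^+ (a - b) * 2 ^+ (a - b).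
  by rewrite -addnn exprD.
have := p2 b; have := p2 (a - b)%N.
set x := 2 ^+ b; set y := 2 ^+ (a - b) => y0 x0.
have := mass_ge0 F m0; have := mass_ge0 E m0.
set M := mass m F; set N := mass m E => N0 M0.
have c1 : 1 <= (a - b).*2.+1%:R :> R by rewrite ler1n.
set c := _%:R in c1 *.
have -> : 2 * (x * y) * (2 * x) * (2 * L * (c * M + (y * y)^-1 * N))
    = 8 * L * (c * (x * x * y) * M + 1 * (x * x / y * N)).
  by field; rewrite gt_eqF.
have -> : c / y * (x * y * (x * y) * M + x * x * N)
    = c * (x * x * y) * M + c * (x * x / y * N).
  by field; rewrite gt_eqF.
rewrite ler_wpM2l ?mulr_ge0 // lerD2l ler_wpM2r // !mulr_ge0 ?invr_ge0 //.
all: exact: ltW.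
Qed.

Lemma bform_sum k (N : nat) (f g : 'I_N -> V -> R) :
  bform m k (fun j => \sum_a f a j) (fun i => \sum_b g b i)
  = \sum_a \sum_b bform m k (f a) (g b).
Proof.
transitivity (\sum_i \sum_a \sum_b m i * g b i * kapply m k (f a) i).
  apply: eq_bigr => i _.
  have -> : kapply m k (fun j => \sum_a f a j) i = \sum_a kapply m k (f a) i.
    rewrite /kapply exchange_big /=; apply: eq_bigr => j _.
    by rewrite big_distrr.
  rewrite mulr_sumr; apply: eq_bigr => a _.
  by rewrite -mulr_suml -mulr_sumr.
by rewrite exchange_big; apply: eq_bigr => a _; rewrite exchange_big.
Qed.

(** Nonzero values are at least 1, so natural exponents suffice; where [f] vanishes, [l] is
    arbitrary and [F] discards the point. *)
Lemma dyadic_decomposition f : (forall i, f i = 0 \/ 1 <= f i) ->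
  exists (l : V -> nat), let F a := [pred i | (f i != 0) && (l i == a)] in
  [/\ forall i a, 0 <= (if F a i then f i else 0) <= 2 ^+ a.+1 * (F a i)%:R,
      forall N i, (forall i, (l i < N)%N) ->
        f i = \sum_(a < N) (if F a i then f i else 0) &
      forall N : nat, \sum_(a < N) 4 ^+ a * mass m (F a) <= sqnorm m f].
Proof.
move=> f1.
have pt i : exists n : nat, f i != 0 -> 2 ^+ n <= f i < 2 ^+ n.+1.
  case: (f1 i) => [->|/dyadic_level[n h]]; last by exists n.
  by exists 0%N; rewrite eqxx.
have [l lP] := choice pt; exists l => F; split.
- move=> i a; rewrite /F /=; case: ifP => [/andP[/lP /andP[l1 l2] /eqP <-]|_].
    by rewrite mulr1 (ltW l2) (le_trans _ l1) // exprn_ge0.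
  by rewrite mulr0 lexx.
- move=> N i lN; rewrite -big_mkcond /F /=; case: (eqVneq (f i) 0) => [e|_].
    by rewrite big1.
  rewrite (big_pred1 (Ordinal (lN i))) // => a.
  by rewrite /= -val_eqE /= eq_sym.
- move=> N.
  apply: (@le_trans _ _ (\sum_(a < N) \sum_(i | F a i) m i * f i ^+ 2)).
    apply: ler_sum => a _; rewrite /mass big_distrr /=.
    apply: ler_sum => i /andP[/lP /andP[l1 _] /eqP <-].
    rewrite mulrC ler_wpM2l //.
    have -> : (4 : R) = 2 ^+ 2 by ring.
    rewrite -exprM mulnC exprM lerXn2r // ?nnegrE ?exprn_ge0 //.
    by apply: le_trans l1; rewrite exprn_ge0.
  under eq_bigr do rewrite big_mkcond /=.
  rewrite exchange_big /=; apply: ler_sum => i _.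
  have X0 : 0 <= m i * f i ^+ 2 by rewrite mulr_ge0 // sqr_ge0.
  rewrite -big_mkcond /=.
  case: (ltnP (l i) N) => lN.
    apply: (@le_trans _ _ (\sum_(a < N | a == Ordinal lN) m i * f i ^+ 2)).
      apply: ler_sum_pred => // a /andP[_].
      by rewrite -val_eqE /= eq_sym.
    by rewrite big_pred1_eq.
  rewrite big_pred0 // => a; rewrite /F /= [l i == a]gtn_eqF ?andbF //.
  exact: leq_trans (ltn_ord a) lN.
Qed.

Lemma bform_ge1_le k (L : R) f g : 0 <= L ->
  log_bounded k L -> log_bounded (transposed k) L ->
  (forall i, f i = 0 \/ 1 <= f i) -> (forall i, g i = 0 \/ 1 <= g i) ->
  `|bform m k f g| <= 96 * L * (sqnorm m f + sqnorm m g).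
Proof.
move=> L0 logk logt f1 g1.
have [lf] := dyadic_decomposition f1; set F := (fun a => _) => -[fF fS fN].
have [lg] := dyadic_decomposition g1; set E := (fun a => _) => -[gE gS gN].
pose N := (\sum_i (lf i + lg i)).+1.
have lN i : (lf i + lg i < N)%N by rewrite ltnS (bigD1 i) //= leq_addr.
have -> : bform m k f g = \sum_(a < N) \sum_(b < N)
    bform m k (fun i => if F a i then f i else 0) (fun i => if E b i then g i else 0).
  rewrite -(bform_sum _ (fun a : 'I_N => fun i => if F a i then f i else 0)
    (fun b : 'I_N => fun i => if E b i then g i else 0)).
  congr bform; apply/funext => i.
    by apply: fS => j; apply: leq_ltn_trans (lN j); rewrite leq_addr.
  by apply: gS => j; apply: leq_ltn_trans (lN j); rewrite leq_addl.
pose x a := 4 ^+ a * mass m (F a); pose y b := 4 ^+ b * mass m (E b).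
apply: (@le_trans _ _ (\sum_(a < N) \sum_(b < N)
    8 * L * (dyadic_coef ((a - b) + (b - a)) * (x a + y b)))).
  apply: le_trans (ler_norm_sum _ _ _) _; apply: ler_sum => a _.
  apply: le_trans (ler_norm_sum _ _ _) _; apply: ler_sum => b _.
  case: (leqP b a) => ba.
    have -> : (b - a = 0)%N by apply/eqP; rewrite subn_eq0.
    by rewrite addn0; apply: level_term.
  have -> : (a - b = 0)%N by apply/eqP; rewrite subn_eq0 ltnW.
  (* When [g] has the higher level, [f] and [g] exchange roles, and the transpose of the transpose
     is [k] again. *)
  rewrite add0n [x a + _]addrC -bform_transposed.
  by apply: level_term => //; exact: ltnW.
have x0 a : 0 <= x a by rewrite mulr_ge0 ?exprn_ge0 ?mass_ge0.
have y0 a : 0 <= y a by rewrite mulr_ge0 ?exprn_ge0 ?mass_ge0.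
apply: (@le_trans _ _ (8 * L * (\sum_(a < N) x a * 12 + \sum_(b < N) y b * 12))).
  under eq_bigr do rewrite -big_distrr /=.
  rewrite -big_distrr /= ler_wpM2l ?mulr_ge0 //.
  have -> : \sum_(a < N) \sum_(b < N) dyadic_coef ((a - b) + (b - a)) * (x a + y b)
     = \sum_(a < N) x a * (\sum_(b < N) dyadic_coef ((a - b) + (b - a)))
     + \sum_(b < N) y b * (\sum_(a < N) dyadic_coef ((a - b) + (b - a))) :> R.
    under [X in _ = X + _]eq_bigr do rewrite big_distrr /=.
    under [X in _ = _ + X]eq_bigr do rewrite big_distrr /=.
    rewrite [X in _ = _ + X]exchange_big -big_split /=; apply: eq_bigr => a _.
    by rewrite -big_split /=; apply: eq_bigr => b _; ring.
  apply: lerD; apply: ler_sum => a _; rewrite ler_wpM2l ?dyadic_coef_sum //.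
  by under eq_bigr do rewrite addnC; exact: dyadic_coef_sum.
rewrite -!mulr_suml -mulrDl.
have h1 := fN N; have h2 := gN N.
have h : \sum_(a < N) x a + \sum_(a < N) y a <= sqnorm m f + sqnorm m g.
  by rewrite lerD.
have -> : 96 * L * (sqnorm m f + sqnorm m g)
  = 8 * L * ((sqnorm m f + sqnorm m g) * 12) by ring.
by rewrite ler_wpM2l ?mulr_ge0 // ler_wpM2r.
Qed.

(** Both sides are homogeneous of degree 2, and on a finite set a single factor lifts all nonzero
    values to at least 1. *)
Lemma bform_ge0_le k (L : R) f g : 0 <= L ->
  log_bounded k L -> log_bounded (transposed k) L ->
  (forall i, 0 <= f i) -> (forall i, 0 <= g i) ->
  `|bform m k f g| <= 96 * L * (sqnorm m f + sqnorm m g).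
Proof.
move=> L0 logk logt f0 g0.
(* Zero values contribute nothing, as their inverse is 0 by convention. *)
pose c := 1 + \sum_i ((f i)^-1 + (g i)^-1).
have iv0 i : 0 <= (f i)^-1 + (g i)^-1 by rewrite addr_ge0 ?invr_ge0.
have c0 : 0 < c by rewrite ltr_wpDr ?sumr_ge0.
have cge i : (f i)^-1 + (g i)^-1 <= c.
  apply: (@le_trans _ _ (\sum_i ((f i)^-1 + (g i)^-1))); last by rewrite lerDr.
  by rewrite [leRHS](bigD1 i) //= lerDl sumr_ge0.
have scaled (h : V -> R) : (forall i, 0 <= h i) -> (forall i, (h i)^-1 <= c) ->
    forall i, c * h i = 0 \/ 1 <= c * h i.
  move=> h0 hc i; case: (eqVneq (h i) 0) => [->|hi]; first by left; rewrite mulr0.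
  right; have hi0 : 0 < h i by rewrite lt_def hi h0.
  by rewrite -ler_pdivrMr // mul1r.
have := @bform_ge1_le k L (fun i => c * f i) (fun i => c * g i) L0 logk logt.
rewrite bformZ !sqnormZ -mulrDr normrM ger0_norm ?mulr_ge0 ?(ltW c0) //.
have c20 : 0 < c * c by rewrite mulr_gt0.
rewrite expr2 [96 * L * _]mulrCA ler_pM2l //; apply.
- apply: scaled => // i; apply: le_trans (cge i); by rewrite lerDl invr_ge0.
- apply: scaled => // i; apply: le_trans (cge i); by rewrite lerDr invr_ge0.
Qed.

(** Each positive or negative part of [f] and [g] occurs in two of the four resulting terms, whence
    twice the constant. *)
Lemma bform_le k (L : R) f g : 0 <= L ->
  log_bounded k L -> log_bounded (transposed k) L ->
  `|bform m k f g| <= 192 * L * (sqnorm m f + sqnorm m g).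
Proof.
move=> L0 logk logt.
pose p (h : V -> R) i := Num.max (h i) 0.
pose n (h : V -> R) i := Num.max (- h i) 0.
have p0 h i : 0 <= p h i by rewrite /p le_max lexx orbT.
have n0 h i : 0 <= n h i by rewrite /n le_max lexx orbT.
have pn h i : h i = p h i - n h i.
  rewrite /p /n; case: (leP (h i) 0) => h0; case: (leP (- h i) 0) => h1; lra.
have sq h : sqnorm m h = sqnorm m (p h) + sqnorm m (n h).
  rewrite /sqnorm -big_split /=; apply: eq_bigr => i _.
  rewrite -mulrDr; congr (_ * _); rewrite /p /n.
  by case: (leP (h i) 0) => h0; case: (leP (- h i) 0) => h1; nra.
have e : bform m k f g = bform m k (p f) (p g) - bform m k (n f) (p g)
    - bform m k (p f) (n g) + bform m k (n f) (n g).
  have ek i : kapply m k f i = kapply m k (p f) i - kapply m k (n f) i.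
    rewrite /kapply -sumrB; apply: eq_bigr => j _.
    by rewrite {1}(pn f j) mulrBr.
  rewrite /bform -!sumrB -big_split /=; apply: eq_bigr => i _.
  by rewrite ek {1}(pn g i); ring.
have B (a b : V -> R) := @bform_ge0_le k L a b L0 logk logt.
have b1 := B _ _ (p0 f) (p0 g); have b2 := B _ _ (n0 f) (p0 g).
have b3 := B _ _ (p0 f) (n0 g); have b4 := B _ _ (n0 f) (n0 g).
rewrite e (sq f) (sq g).
apply: le_trans (ler_normD _ _) _; apply: le_trans (lerD (ler_normB _ _) (lexx _)) _.
apply: le_trans (lerD (lerD (ler_normB _ _) (lexx _)) (lexx _)) _.
lra.
Qed.

End Interpolation.

(** * The theorem for finitely many weighted points *)

Definition discrete_const {R : realType} (A G s delta C : R) : R :=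
  4 * (192 * log_const A G s delta (8 * C)) ^+ 2.

Theorem discrete_T1 (R : realType) (V : finType) (m : V -> R)
    (d k : V -> V -> R) (A G s delta C : R) :
  growth_space m d G s -> standard_kernel d k A s delta ->
  standard_kernel d (transposed k) A s delta -> 0 < C ->
  (forall S : pred V, \sum_(i | S i) m i * `|kint k m S i| <= C * mass m S) ->
  forall f, sqnorm m (kapply m k f)
            <= discrete_const A G s delta C * sqnorm m f.
Proof.
move=> gs sk skt C0 T1 f.
have m0 := gs_mass gs.
have C40 : 0 <= 4 * C by lra.
have H0 : 0 < 8 * C by lra.
(* The passage to pairings costs a factor 4 and the return to the L^1 norm a factor 2, which is the
   [8 * C] of [discrete_const]; it yields the bound for the transpose as well. *)
have pb := pairing_bound m0 (ltW C0) T1.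
have pbt Q E : `|pairing (transposed k) m Q E| <= 4 * C * (mass m Q + mass m E).
  by rewrite pairing_transposed addrC pb.
have e8 : 2 * (4 * C) = 8 * C by ring.
have rk := sum_norm_kint_le m0 C40 pb; rewrite e8 in rk.
have rt := sum_norm_kint_le m0 C40 pbt; rewrite e8 in rt.
have lk : log_bounded m k _ := log_restricted gs sk H0 rk.
have lt' : log_bounded m (transposed k) _ := log_restricted gs skt H0 rt.
have L0 := log_const_gt0 gs sk H0.
apply: sqnorm_kapply_le => //; first by rewrite mulr_gt0.
by move=> g; apply: bform_le => //; exact: ltW.
Qed.

Local Open Scope classical_set_scope.

(** * Integrals with respect to a finite measure *)

Section FiniteMeasureIntegrals.
Context {disp : measure_display} {T : measurableType disp} {R : realType}.
Variable mu : {finite_measure set T -> \bar R}.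
Implicit Types (f g : T -> R) (P : set T).

Definition summable_fun f : Prop := mu.-integrable setT (EFin \o f).

Lemma summable_measurable f : summable_fun f -> measurable_fun setT f.
Proof. by move=> /measurable_int/measurable_EFinP. Qed.

Lemma summable_dom f g : measurable_fun setT g ->
  (forall x, `|g x| <= `|f x|) -> summable_fun f -> summable_fun g.
Proof.
move=> mg gf; apply: le_integrable => //; first exact/measurable_EFinP.
by move=> x _ /=; rewrite lee_fin.
Qed.

Lemma summable_cst (c : R) : summable_fun (fun=> c).
Proof. exact: finite_measure_integrable_cst. Qed.

Lemma summable_bounded (c : R) g : measurable_fun setT g ->
  (forall x, `|g x| <= c) -> summable_fun g.
Proof.
move=> mg gc; apply: summable_dom mg _ (summable_cst c) => x.
exact: le_trans (gc x) (ler_norm _).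
Qed.

Lemma summableD f g : summable_fun f -> summable_fun g ->
  summable_fun (fun x => f x + g x).
Proof. by move=> sf sg; exact: (integrableD measurableT sf sg). Qed.

Lemma summableZ (c : R) f : summable_fun f -> summable_fun (fun x => c * f x).
Proof.
move=> sf; apply: eq_integrable (integrableZl measurableT c sf) => // x _.
Qed.

Lemma summable_norm f : summable_fun f -> summable_fun (fun x => `|f x|).
Proof. by move=> sf; exact: integrable_norm sf. Qed.

Lemma summable_sum (n : nat) (F : 'I_n -> T -> R) :
  (forall i, summable_fun (F i)) -> summable_fun (fun x => \sum_i F i x).
Proof.
elim: n F => [|n IH] F sF.
  by under eq_fun do rewrite big_ord0; exact: summable_cst.
under eq_fun do rewrite big_ord_recl.
by apply: summableD => //; apply: IH.
Qed.

Lemma summableM (c : R) f g : measurable_fun setT g -> (forall x, `|g x| <= c) ->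
  summable_fun f -> summable_fun (fun x => g x * f x).
Proof.
move=> mg gc sf; apply: summable_dom (summableZ c sf).
  by apply: measurable_funM => //; exact: summable_measurable.
move=> x; rewrite !normrM ler_wpM2r //.
exact: le_trans (gc x) (ler_norm _).
Qed.

Lemma summable_sqr f : measurable_fun setT f ->
  summable_fun (fun x => f x ^+ 2) -> summable_fun f.
Proof.
move=> mf s2; apply: summable_dom (summableD (summable_cst 1) s2) => // x.
rewrite [leRHS]ger0_norm ?addr_ge0 ?sqr_ge0 // -(real_normK (num_real (f x))).
have := sqr_ge0 (`|f x| - 1); have := normr_ge0 (f x); nra.
Qed.

Lemma RintD f g : summable_fun f -> summable_fun g ->
  \int[mu]_x (f x + g x) = \int[mu]_x f x + \int[mu]_x g x.
Proof. by move=> sf sg; rewrite RintegralD. Qed.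

Lemma RintZ (c : R) f : summable_fun f ->
  \int[mu]_x (c * f x) = c * \int[mu]_x f x.
Proof. by move=> sf; rewrite RintegralZl. Qed.

Lemma Rint_sum (n : nat) (F : 'I_n -> T -> R) :
  (forall i, summable_fun (F i)) ->
  \int[mu]_x (\sum_i F i x) = \sum_i \int[mu]_x F i x.
Proof.
elim: n F => [|n IH] F sF.
  rewrite big_ord0; under eq_Rintegral do rewrite big_ord0.
  by rewrite Rintegral_cst // mul0r.
rewrite big_ord_recl; under eq_Rintegral do rewrite big_ord_recl.
by rewrite RintD ?IH //; apply: summable_sum.
Qed.

Lemma le_Rint f g : summable_fun f -> summable_fun g ->
  (forall x, f x <= g x) -> \int[mu]_x f x <= \int[mu]_x g x.
Proof. by move=> sf sg fg; apply: le_Rintegral. Qed.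

Lemma le_norm_Rint f g : measurable_fun setT f -> summable_fun g ->
  (forall x, `|f x| <= g x) -> `|\int[mu]_x f x| <= \int[mu]_x g x.
Proof.
move=> mf sg fg.
have sf : summable_fun f.
  by apply: summable_dom mf _ sg => x; exact: le_trans (fg x) (ler_norm _).
apply: le_trans (le_normr_Rintegral measurableT sf) _.
by apply: le_Rint => //; exact: summable_norm.
Qed.

Lemma measurable_indicT P : measurable P -> measurable_fun setT (\1_P : T -> R).
Proof. exact: measurable_indic. Qed.

Lemma indic01 P x : 0 <= (\1_P x : R) <= 1.
Proof. by rewrite indicE; case: (_ \in _); rewrite /= ?lexx ler01. Qed.

Lemma norm_indic_le1 P x : `|\1_P x : R| <= 1.
Proof. by have /andP[h ?] := indic01 P x; rewrite ger0_norm. Qed.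

Lemma summable_indic P f : measurable P -> summable_fun f ->
  summable_fun (fun x => \1_P x * f x).
Proof.
move=> mP; apply: (@summableM 1); first exact: measurable_indicT.
exact: norm_indic_le1.
Qed.

Lemma summable_indic1 P : measurable P -> summable_fun (\1_P : T -> R).
Proof.
move=> mP; apply: (@summable_bounded 1); first exact: measurable_indicT.
exact: norm_indic_le1.
Qed.

Lemma Rint_indic P : measurable P -> \int[mu]_x (\1_P x) = fine (mu P).
Proof. by move=> mP; rewrite /Rintegral integral_indic // setIT. Qed.

(** Cauchy-Schwarz, from a quadratic inequality in [l]; if [P] is null, a large [l] forces the
    integral of [|f|] over [P] to vanish. *)
Lemma Rint_indic_sqr P f : measurable P -> measurable_fun setT f ->
  summable_fun (fun x => f x ^+ 2) ->
  (\int[mu]_x (\1_P x * `|f x|)) ^+ 2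
    <= fine (mu P) * \int[mu]_x (\1_P x * f x ^+ 2).
Proof.
move=> mP mf s2.
have sf := summable_sqr mf s2.
have s1 : summable_fun (fun x => \1_P x * `|f x|).
  by apply: summable_indic => //; exact: summable_norm.
have s3 : summable_fun (fun x => \1_P x * f x ^+ 2) by exact: summable_indic.
have sP := summable_indic1 mP.
rewrite -Rint_indic //.
set a := \int[mu]_x _; set p := \int[mu]_x _; set b := \int[mu]_x _.
have a0 : 0 <= a.
  by apply: Rintegral_ge0 => x _; rewrite mulr_ge0 //; case/andP: (indic01 P x).
have p0 : 0 <= p.
  by apply: Rintegral_ge0 => x _; case/andP: (indic01 P x).
have b0 : 0 <= b.
  by apply: Rintegral_ge0 => x _; rewrite mulr_ge0 ?sqr_ge0.
have key (l : R) : 2 * l * a <= b + l ^+ 2 * p.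
  rewrite -!RintZ // -RintD //; last exact: summableZ.
  apply: le_Rint => [||x].
  - exact: summableZ.
  - by apply: summableD => //; exact: summableZ.
  have /andP[h _] := indic01 P x.
  rewrite -(real_normK (num_real (f x))).
  have := sqr_ge0 (`|f x| - l); have := normr_ge0 (f x); nra.
case: (ltrgt0P p) => [pp|pn|p00].
- have := key (a / p).
  have -> : 2 * (a / p) * a = 2 * (a ^+ 2 / p) by field; rewrite gt_eqF.
  have -> : (a / p) ^+ 2 * p = a ^+ 2 / p by field; rewrite gt_eqF.
  have -> : (2 * (a ^+ 2 / p) <= b + a ^+ 2 / p) = (a ^+ 2 / p <= b).
    by apply/idP/idP; lra.
  by rewrite ler_pdivrMr // mulrC.
- by move: p0; rewrite leNgt pn.
- rewrite p00 mul0r; have a00 : a <= 0.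
    rewrite leNgt; apply/negP => ap.
    have := key ((b + 1) / (2 * a)); rewrite p00 mulr0 addr0.
    have -> : 2 * ((b + 1) / (2 * a)) * a = b + 1 by field; rewrite gt_eqF.
    lra.
  have -> : a = 0 by lra.
  by rewrite expr0n /= lexx.
Qed.

End FiniteMeasureIntegrals.

(** * Measurability of the truncated operators *)

Section MetricMeasurability.
Context {R : realType} {X : pmetricType R}.
Implicit Types (x y z : X) (eps : R).

(* [metric_sym] and [metric_triangle], restated so that the distance is taken
   in [R] as a [realType]: [lra] compares atoms syntactically. *)
Lemma pdist_sym x y : mdist x y = mdist y x.
Proof. exact: metric_sym. Qed.

Lemma pdist_triangle x y z : mdist x z <= mdist x y + mdist y z.
Proof. exact: metric_triangle. Qed.

Lemma dense_sequence : separable X ->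
  exists q : nat -> X, forall x (r : R), 0 < r -> exists i, mdist (q i) x < r.
Proof.
move=> [D /countable_injP[g ginj] dD].
exists (fun n => xget point [set x | D x /\ g x = n]) => x r r0.
have [|z [xz Dz]] := dD (interior (ball x r)) _ (open_interior _).
  by exists x; exact: nbhsx_ballx.
exists (g z); case: xgetP => [y _ [Dy gy]|/(_ z)]; last by move=> h; exfalso; apply: h.
have -> : y = z by apply: ginj; rewrite ?inE.
by have /= := interior_subset xz; rewrite ballEmdist /= pdist_sym.
Qed.

Lemma measurable_ball x (r : R) : measurable (ball x r : set (borel X)).
Proof.
apply: sub_sigma_algebra; rewrite openE => y; rewrite ballEmdist /= => xy.
rewrite /interior -nbhs_ballE; exists (r - mdist x y); first by rewrite /= subr_gt0.
move=> z; rewrite !ballEmdist /= => yz.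
by have := pdist_triangle x y z; lra.
Qed.

Definition pair_open (W : set (X * X)) : Prop := forall p, W p ->
  exists2 r : R, 0 < r &
    forall q, mdist p.1 q.1 < r -> mdist p.2 q.2 < r -> W q.

(* Separability makes the product of the Borel sigma-algebras contain the open
   sets of the product. *)
Lemma pair_open_measurable (W : set (X * X)) : separable X -> pair_open W ->
  measurable (W : set (borel X * borel X)).
Proof.
move=> /dense_sequence[q qd] Wo.
pose rect i j (k : nat) : set (borel X * borel X) :=
  (ball (q i) (k.+1%:R^-1 : R) : set (borel X)) `*`
  (ball (q j) (k.+1%:R^-1 : R) : set (borel X)).
have -> : W = \bigcup_i \bigcup_j
    \bigcup_(k in [set k | rect i j k `<=` W]) rect i j k.
  apply/seteqP; split => [p Wp|p [i _ [j _ [k kW]]]]; last exact: kW.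
  have [r r0 rW] := Wo p Wp.
  have [k kr] : exists k : nat, k.+1%:R^-1 < r / 2.
    exists (Num.bound (r / 2)^-1); rewrite invf_plt ?posrE ?divr_gt0 //.
    apply: lt_trans (archi_boundP _) _; first by rewrite invr_ge0 divr_ge0 // ltW.
    by rewrite ltr_nat.
  have k0 : 0 < k.+1%:R^-1 :> R by rewrite invr_gt0.
  have [i qi] := qd p.1 _ k0; have [j qj] := qd p.2 _ k0.
  exists i => //; exists j => //; exists k; last first.
    by split; rewrite /= ballEmdist.
  move=> [a b] [] /=; rewrite !ballEmdist /= => qa qb.
  set e := k.+1%:R^-1 in kr k0 qi qj qa qb.
  apply: rW => /=.
    by have := pdist_triangle p.1 (q i) a; rewrite (pdist_sym p.1 (q i)); lra.
  by have := pdist_triangle p.2 (q j) b; rewrite (pdist_sym p.2 (q j)); lra.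
apply: bigcupT_measurable => i; apply: bigcupT_measurable => j.
apply: bigcup_measurable => k _.
by apply: measurableX; exact: measurable_ball.
Qed.

Record real_kernel (u : X -> X -> R) (A s delta : R) : Prop := RealKernel {
  rk_const : 0 < A;
  rk_exp : 0 < s;
  rk_delta : 0 < delta;
  rk_size : forall x y, x <> y -> `|u x y| <= A / mdist x y `^ s;
  rk_smoothl : forall x x' y, x <> y -> mdist x x' <= mdist x y / 2 ->
    `|u x y - u x' y| <= A * (mdist x x' `^ delta / mdist x y `^ (s + delta));
  rk_smoothr : forall x x' y, x <> y -> mdist x x' <= mdist x y / 2 ->
    `|u y x - u y x'| <= A * (mdist x x' `^ delta / mdist x y `^ (s + delta)) }.

Definition cut (u : X -> X -> R) eps x y : R :=
  if eps <= mdist x y then u x y else 0.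

Section Kernel.
Variables (u : X -> X -> R) (A s delta eps : R).
Hypothesis rk : real_kernel u A s delta.
Hypothesis eps0 : 0 < eps.

Let A0 := rk_const rk.
Let s0 := rk_exp rk.
Let delta0 := rk_delta rk.

Lemma cut_le x y : `|cut u eps x y| <= A / eps `^ s.
Proof.
have h : 0 <= A / eps `^ s by rewrite divr_ge0 ?powR_ge0 // ltW.
rewrite /cut; case: (leP eps) => [xy|_]; last by rewrite normr0.
have xy0 : 0 < mdist x y by apply: lt_le_trans xy.
apply: le_trans (rk_size rk _) _; first by apply/eqP; rewrite -mdist_gt0.
rewrite ler_wpM2l ?(ltW A0) // lef_pV2 ?posrE ?powR_gt0 //.
by rewrite powR_monor // ltW.
Qed.

Lemma kernel_near_le x x' y y' (r t : R) : 0 < t -> 2 * t <= r ->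
  r <= mdist x y -> r <= mdist x' y -> mdist x x' <= t -> mdist y y' <= t ->
  `|u x y - u x' y'| <= 2 * A * (t `^ delta / r `^ (s + delta)).
Proof.
move=> t0 tr xy x'y xx' yy'.
have r0 : 0 < r by lra.
have neq z w : r <= mdist z w -> z <> w.
  by move=> zw; apply/eqP; rewrite -mdist_gt0; lra.
have est z z' w : r <= mdist z w -> mdist z z' <= t ->
    A * (mdist z z' `^ delta / mdist z w `^ (s + delta))
      <= A * (t `^ delta / r `^ (s + delta)).
  move=> zw zz'; rewrite ler_wpM2l ?(ltW A0) //.
  apply: ler_pM; rewrite ?invr_ge0 ?powR_ge0 //.
    by rewrite powR_monor ?mdist_ge0 // ltW.
  rewrite lef_pV2 ?posrE ?powR_gt0 //; last by lra.
  by rewrite powR_monor // ?ltW // addr_gt0.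
have yx' : r <= mdist y x' by rewrite pdist_sym.
have h1 : `|u x y - u x' y| <= A * (t `^ delta / r `^ (s + delta)).
  apply: le_trans (est _ _ _ xy xx').
  by apply: (rk_smoothl rk); [exact: neq|lra].
have h2 : `|u x' y - u x' y'| <= A * (t `^ delta / r `^ (s + delta)).
  apply: le_trans (est _ _ _ yx' yy').
  by apply: (rk_smoothr rk); [exact: neq|lra].
have := ler_normD (u x y - u x' y) (u x' y - u x' y').
by rewrite addrA subrK; lra.
Qed.

(** Measurability of the kernel comes from its regularity: on the closed set [D] it is jointly
    continuous, so its superlevel sets are traces on [D] of open sets. *)
Lemma measurable_cut : separable X ->
  measurable_fun setT (fun p : borel X * borel X => cut u eps p.1 p.2).
Proof.
move=> sepX.
pose D : set (borel X * borel X) := [set p | eps <= mdist (p.1 : X) p.2].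
have tri2 (p q : X * X) : mdist p.1 p.2 <= mdist p.1 q.1 + mdist q.1 q.2 + mdist p.2 q.2.
  have := pdist_triangle p.1 q.1 p.2; have := pdist_triangle q.1 q.2 p.2.
  by rewrite (pdist_sym q.2 p.2); lra.
have mD : measurable D.
  rewrite -[D]setCK; apply: measurableC; apply: pair_open_measurable => // -[p1 p2].
  set p := (p1, p2) : X * X.
  rewrite /D /= => /negP; rewrite -ltNge => pe.
  exists ((eps - mdist p.1 p.2) / 2); first by rewrite divr_gt0 // subr_gt0.
  rewrite /p /=; move=> q h1 h2; apply/negP; rewrite -ltNge.
  by have := tri2 q p; rewrite /p /= (pdist_sym q.1 p1) (pdist_sym q.2 p2); lra.
have -> : (fun p : borel X * borel X => cut u eps p.1 p.2) =
    (fun p => u p.1 p.2) \_ D.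
  apply/funext => p; rewrite patchE /cut.
  case: (leP eps) => pe; first by rewrite mem_set.
  by rewrite memNset // /D /=; apply/negP; rewrite -ltNge.
apply/(measurable_restrict _ mD measurableT).
rewrite setTI; apply: (measurability _ (RGenOInfty.measurableE R)) => //.
move=> /= _ [_ [a ->] <-].
(* The points with a neighbourhood in which [u > a] on [D]; this is open by construction, whatever
   [u] does off [D]. *)
pose W : set (X * X) := [set p | exists2 r : R, 0 < r & forall q,
  mdist p.1 q.1 < r -> mdist p.2 q.2 < r -> eps <= mdist q.1 q.2 -> a < u q.1 q.2].
have -> : D `&` (fun p : borel X * borel X => u p.1 p.2) @^-1` `]a, +oo[
    = D `&` (W : set (borel X * borel X)).
  apply/seteqP; split => p [Dp]; last first.
    move=> [r r0 Wp]; split => //; rewrite /= in_itv /= andbT.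
    by apply: Wp; rewrite ?mdistxx.
  rewrite /= in_itv /= andbT => au; split => //.
  rewrite /D /= in Dp.
  pose c := 2 * A / (eps / 2) `^ (s + delta).
  have c0 : 0 < c by rewrite divr_gt0 ?mulr_gt0 ?powR_gt0 // divr_gt0.
  pose g := (u p.1 p.2 - a) / 2.
  have g0 : 0 < g by rewrite divr_gt0 // subr_gt0.
  (* Chosen to keep the oscillation below half the gap [u - a]. The intermediate pair may leave [D],
     but with [t <= eps / 4] its distance stays above [eps / 2]. *)
  pose t := Num.min (eps / 4) ((g / c) `^ delta^-1).
  have t0 : 0 < t by rewrite lt_min divr_gt0 //= powR_gt0 // divr_gt0.
  exists t => // q pq1 pq2 qe.
  have t4 : t <= eps / 4 by rewrite ge_min lexx.
  have tg : t `^ delta <= g / c.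
    apply: (@le_trans _ _ (((g / c) `^ delta^-1) `^ delta)).
      by rewrite powR_monor // ?(ltW delta0) ?(ltW t0) // ge_min lexx orbT.
    by rewrite -powRrM mulVf ?gt_eqF // powRr1 // divr_ge0 // ltW.
  have near : `|u p.1 p.2 - u q.1 q.2| <= g.
    apply: le_trans (@kernel_near_le p.1 q.1 p.2 q.2 (eps / 2) t t0 _ _ _ _ _) _.
    - by lra.
    - by lra.
    - have := pdist_triangle q.1 p.2 q.2; lra.
    - exact: ltW.
    - exact: ltW.
    - rewrite mulrA mulrAC -/c mulrC; apply: le_trans (ler_wpM2r (ltW c0) tg) _.
      by rewrite divfK // gt_eqF.
  by move: near; rewrite ler_norml => /andP[_]; rewrite /g; lra.
apply: measurableI => //; apply: pair_open_measurable => // p [r r0 Wp].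
exists (r / 2); first by rewrite divr_gt0.
move=> q h1 h2; exists (r / 2); first by rewrite divr_gt0.
move=> z q1 q2; apply: Wp.
  by have := pdist_triangle p.1 q.1 z.1; lra.
by have := pdist_triangle p.2 q.2 z.2; lra.
Qed.

Lemma measurable_cut_section x : separable X ->
  measurable_fun setT (cut u eps x : borel X -> R).
Proof.
move=> sepX.
exact: (measurableT_comp (measurable_cut sepX) (pair1_measurable (x : borel X))).
Qed.

Section Operator.
Variable eta : {finite_measure set (borel X) -> \bar R}.
Hypothesis sepX : separable X.

Definition cut_op (f : borel X -> R) (x : borel X) : R :=
  \int[eta]_y (cut u eps x y * f y).

Lemma summable_cut f x : summable_fun eta f ->
  summable_fun eta (fun y => cut u eps x y * f y).
Proof.
apply: summableM; first exact: measurable_cut_section.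
exact: cut_le.
Qed.

(** Tonelli is applied to the positive and the negative part separately, so no integrability on the
    product is required; where an integral is infinite, [fine] supplies a default value and stays
    measurable. *)
Lemma measurable_cut_op f : measurable_fun setT f ->
  measurable_fun setT (cut_op f).
Proof.
move=> mf.
pose F (p : borel X * borel X) : \bar R := (cut u eps p.1 p.2 * f p.2)%:E.
have mF : measurable_fun setT F.
  apply/measurable_EFinP; apply: measurable_funM; first exact: measurable_cut.
  exact: measurableT_comp.
have mp := @measurable_fun_fubini_tonelli_F _ _ _ _ _ eta _
  (measurable_funepos mF) (fun p => funepos_ge0 _ _).
have mn := @measurable_fun_fubini_tonelli_F _ _ _ _ _ eta _
  (measurable_funeneg mF) (fun p => funeneg_ge0 _ _).
have -> : cut_op f = fun x => fine (fubini_F eta F^\+ x - fubini_F eta F^\- x)%E.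
  apply/funext => x; rewrite /cut_op /Rintegral /fubini_F integralE.
  by congr (fine (_ - _)%E); apply: eq_integral => y _; rewrite ?funeposE ?funenegE.
apply: (measurableT_comp (fine_measurable measurableT)).
exact: emeasurable_funB.
Qed.

End Operator.

End Kernel.
End MetricMeasurability.

(** * Discretization *)

Section Discretization.
Context {R : realType} {X : pmetricType R}.

(** Countably many small balls cover the space. Since the measure is finite, finitely many of them
    leave a rest of measure at most [z]; removing the earlier balls makes the cells disjoint. *)
Lemma exists_cells (eta : {finite_measure set (borel X) -> \bar R}) (t z : R) :
  separable X -> 0 < t -> 0 < z ->
  exists (n : nat) (c : 'I_n -> X) (P : 'I_n -> set (borel X)),
    [/\ forall i, measurable (P i), forall i x, P i x -> mdist (c i) x < t,
        forall i j x, P i x -> P j x -> i = j &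
        fine (eta [set x | forall i, ~ P i x]) <= z].
Proof.
move=> /dense_sequence[q qd] t0 z0.
pose B k : set (borel X) := ball (q k) t.
pose U k : set (borel X) := \bigcup_(l in [set l | (l < k)%N]) B l.
have mB k : measurable (B k) by exact: measurable_ball.
have mU k : measurable (U k) by apply: bigcup_measurable.
pose Z k := ~` U k.
have mZ k : measurable (Z k) by exact: measurableC.
have capZ : \bigcap_k Z k = set0.
  apply/seteqP; split => // x xZ; have [k xk] := qd (x : X) _ t0.
  by have := xZ k.+1 I; apply; exists k => //=; rewrite /B ballEmdist.
have [n nz] : exists n, fine (eta (Z n)) <= z.
  have : eta \o Z @ \oo --> eta (\bigcap_k Z k).
    apply: nonincreasing_cvg_mu => //.
    - by rewrite ltey_eq fin_num_measure.
    - by rewrite capZ.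
    - move=> k l kl; apply/subsetPset => x Zx [j /= jk Bx]; apply: Zx.
      by exists j => //=; exact: leq_trans kl.
  rewrite capZ measure0 => /fine_cvgP[_ /cvgrPdist_le /(_ z z0) [n _ h]].
  exists n; have := h n (leqnn n).
  by rewrite /= sub0r normrN; apply: le_trans; exact: ler_norm.
exists n, (fun i => q i), (fun i => B i `\` U i); split.
- by move=> i; exact: measurableD.
- by move=> i x [Bx _]; move: Bx; rewrite /B ballEmdist.
- move=> i j x [Bi Ui] [Bj Uj]; apply/val_inj/eqP.
  by case: ltngtP => // ij; [case: Uj; exists i|case: Ui; exists j].
- rewrite (_ : [set x | _] = Z n) //; apply/seteqP; split => x h.
    move=> [k /= kn Bk].
    have ex : exists l, `[< B l x >] by exists k; apply/asboolP.
    case: (ex_minnP ex) => l /asboolP Bl lmin.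
    have ln : (l < n)%N by apply: leq_ltn_trans kn; apply/lmin/asboolP.
    apply: (h (Ordinal ln)); split => //= -[j /= jl Bj].
    by have := lmin j; rewrite leqNgt jl => /(_ (asboolT Bj)).
  by move=> i [Bi _]; apply: h; exists i => /=.
Qed.

(** Every modified distance is at least [eps], so the smoothness condition is only tested when [j]
    is at distance at least [2 * eps] from [i]. Then [j] is at distance at least [eps] from [l] too,
    and the jump of the truncation is never seen. *)
Lemma cut_standard_kernel (V : finType) (c : V -> X) (u : X -> X -> R)
    (A s delta eps : R) : real_kernel u A s delta -> 0 < eps ->
  standard_kernel (fun i j => Num.max (mdist (c i) (c j)) eps)
    (fun i j => cut u eps (c i) (c j)) A s delta.
Proof.
move=> rk eps0.
have A0 := rk_const rk; have s0 := rk_exp rk; have delta0 := rk_delta rk.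
split => // [i j|i l j].
  rewrite /cut; case: (leP eps (mdist (c i) (c j))) => h; last first.
    by rewrite normr0 divr_ge0 ?powR_ge0 // ltW.
  apply: rk_size rk _ _ _; apply/eqP; rewrite -mdist_gt0.
  exact: lt_le_trans h.
have e1 : eps <= Num.max (mdist (c i) (c l)) eps by rewrite le_max lexx orbT.
have e2 : mdist (c i) (c l) <= Num.max (mdist (c i) (c l)) eps.
  by rewrite le_max lexx.
move=> half.
have big : 2 * eps <= Num.max (mdist (c i) (c j)) eps by lra.
have ij : Num.max (mdist (c i) (c j)) eps = mdist (c i) (c j).
  by case: (leP (mdist (c i) (c j)) eps) big => // h1 h2; lra.
rewrite ij in half big *.
have lj : eps <= mdist (c l) (c j).
  have := pdist_triangle (c i) (c l) (c j); lra.
rewrite /cut lj ifT; last by lra.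
have ij0 : 0 < mdist (c i) (c j) by lra.
apply: le_trans (rk_smoothl rk _ _) _.
- by apply/eqP; rewrite -mdist_gt0.
- lra.
rewrite ler_wpM2l ?(ltW A0) // ler_wpM2r ?invr_ge0 ?powR_ge0 //.
by rewrite powR_monor ?mdist_ge0 // ltW.
Qed.

Lemma real_kernel_flip (u : X -> X -> R) (A s delta : R) :
  real_kernel u A s delta -> real_kernel (fun x y => u y x) A s delta.
Proof.
case=> A0 s0 d0 size sl sr; split => // x y xy.
by rewrite pdist_sym; apply: size => yx; exact: xy.
Qed.

Section Cells.
Variables (u : X -> X -> R) (A s delta eps : R).
Hypothesis rk : real_kernel u A s delta.
Hypothesis eps0 : 0 < eps.
Variable eta : {finite_measure set (borel X) -> \bar R}.
Hypothesis sepX : separable X.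
Hypothesis sig : Sigma s eta.
Variable t : R.
Hypotheses (t0 : 0 < t) (t4 : 4 * t <= eps).
Variables (n : nat) (c : 'I_n -> X) (P : 'I_n -> set (borel X)).
Hypothesis mP : forall i, measurable (P i).
Hypothesis Pc : forall i x, P i x -> mdist (c i) x < t.
Hypothesis Pinj : forall i j x, P i x -> P j x -> i = j.

Let A0 := rk_const rk.
Let s0 := rk_exp rk.
Let delta0 := rk_delta rk.

Let Z : set (borel X) := [set x | forall i, ~ P i x].

Let total : R := fine (eta setT).

Let m i : R := fine (eta (P i)).

Let dd (i j : 'I_n) : R := Num.max (mdist (c i) (c j)) eps.

Let kk (i j : 'I_n) : R := cut u eps (c i) (c j).

Let M : R := A / eps `^ s.

Let theta : R := 2 * A * (t `^ delta / eps `^ (s + delta)).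

(* Bounds the error made by evaluating the kernel at the centres. *)
Let err (i j : 'I_n) : R := 2 * M * (dd i j < 2 * eps)%R%:R + theta.

Let M0 : 0 < M.
Proof. by rewrite divr_gt0 ?powR_gt0. Qed.

Let theta0 : 0 <= theta.
Proof. by rewrite !mulr_ge0 ?invr_ge0 ?powR_ge0 // ltW. Qed.

Let err0 i j : 0 <= err i j.
Proof. by rewrite /err addr_ge0 // mulr_ge0 ?ler0n // mulr_ge0 // (ltW M0). Qed.

Lemma in_cell i x : P i x -> forall j, (\1_(P j) x : R) = (i == j)%:R.
Proof.
move=> Pix j; rewrite indicE; case: eqVneq => [<-|ij].
  by rewrite mem_set.
by rewrite memNset // => Pjx; move/eqP: ij; apply; exact: Pinj Pix Pjx.
Qed.

Lemma cell_sum_in i x (g : 'I_n -> R) : P i x -> \sum_j \1_(P j) x * g j = g i.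
Proof.
move=> Pix; rewrite (bigD1 i) //= (in_cell Pix) eqxx mul1r big1 ?addr0 // => j ji.
by rewrite (in_cell Pix) eq_sym (negbTE ji) mul0r.
Qed.

Lemma cell_sum_out x (g : 'I_n -> R) : Z x -> \sum_j \1_(P j) x * g j = 0.
Proof.
by move=> Zx; rewrite big1 // => j _; rewrite indicE memNset ?mul0r.
Qed.

Lemma cell_or_rest x : (exists i, P i x) \/ Z x.
Proof.
by case: (pselect (exists i, P i x)) => [|h]; [left|right => i Pi; apply: h; exists i].
Qed.

Lemma rest_indic_in i x : P i x -> (\1_Z x : R) = 0.
Proof. by move=> Pix; rewrite indicE memNset // => /(_ i). Qed.

Lemma measurable_rest : measurable Z.
Proof.
have -> : Z = \bigcap_(i in [set: 'I_n]) ~` (P i).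
  by apply/seteqP; split => x h i; [move=> _|]; exact: h.
by apply: fin_bigcap_measurable => // i _; exact: measurableC.
Qed.

Lemma sum_mass_le (b : 'I_n -> R) (B : set (borel X)) : measurable B ->
  (forall i, 0 <= b i <= 1) -> (forall i x, b i != 0 -> P i x -> B x) ->
  \sum_i b i * m i <= fine (eta B).
Proof.
move=> mB b01 bB.
have si i : summable_fun eta (fun x => b i * \1_(P i) x).
  by apply: summableZ; exact: summable_indic1.
have -> : \sum_i b i * m i = \int[eta]_x (\sum_i b i * \1_(P i) x).
  rewrite Rint_sum //; apply: eq_bigr => i _.
  by rewrite RintZ ?Rint_indic //; exact: summable_indic1.
rewrite -Rint_indic //; apply: le_Rint => [||x].
- exact: summable_sum.
- exact: summable_indic1.
under eq_bigr do rewrite mulrC.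
case: (cell_or_rest x) => [[i Pix]|Zx]; last first.
  by rewrite cell_sum_out //; case/andP: (indic01 (R := R) B x).
rewrite (cell_sum_in _ Pix); case: (eqVneq (b i) 0) => [->|bi].
  by case/andP: (indic01 (R := R) B x).
by rewrite indicE mem_set; [case/andP: (b01 i)|exact: bB bi Pix].
Qed.

Lemma cell_mass_ge0 i : 0 <= m i.
Proof. exact: fine_ge0. Qed.

Lemma mass_total : \sum_i m i <= total.
Proof.
have := @sum_mass_le (fun=> 1) setT measurableT.
under eq_bigr do rewrite mul1r.
by apply => // i; rewrite ler01 lexx.
Qed.

(** A ball that is not empty has [r > eps], so the cells centred in it are shorter than [r] and lie
    in the true ball of radius [2 * r]. *)
Lemma cells_growth : growth_space m dd (2 `^ s) s.
Proof.
split => //.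
- exact: cell_mass_ge0.
- by move=> i j; rewrite lt_max eps0 orbT.
- by move=> i j; rewrite /dd pdist_sym.
- move=> i j l; rewrite /dd ge_max; apply/andP; split.
    apply: le_trans (pdist_triangle _ (c j) _) _.
    by apply: lerD; rewrite le_max lexx.
  rewrite -[leLHS]addr0; apply: lerD; rewrite le_max ?lexx ?orbT //.
  by rewrite mdist_ge0.
move=> i r r0.
have -> : mass m (dball dd i r) = \sum_j (dd i j < r)%R%:R * m j.
  rewrite /mass big_mkcond /=; apply: eq_bigr => j _.
  by rewrite /dball /=; case: ifP => _; rewrite ?mul1r ?mul0r.
have r20 : 0 < 2 * r by rewrite mulr_gt0.
rewrite -powRM ?ler0n ?(ltW r0) //.
apply: (@le_trans _ _ (fine (eta (ball (c i) (2 * r))))); last first.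
  have := sig (c i) r20; rewrite -lee_fin fineK // fin_num_measure //.
  exact: measurable_ball.
apply: sum_mass_le => [|j|j x].
- exact: measurable_ball.
- by case: ltP; rewrite ?lexx ?ler01.
rewrite pnatr_eq0 eqb0 negbK => dr /Pc cx; rewrite ballEmdist /=.
have h1 : mdist (c i) (c j) < r by apply: le_lt_trans dr; rewrite le_max lexx.
have h2 : eps < r by apply: le_lt_trans dr; rewrite le_max lexx orbT.
apply: le_lt_trans (pdist_triangle (c i) (c j) x) _.
have h3 : mdist (c j) x < r by apply: lt_trans cx _; have := t4; have := t0; lra.
by rewrite mulr_natl mulr2n ltrD.
Qed.

Lemma cells_kernel : standard_kernel dd kk A s delta.
Proof. exact: cut_standard_kernel. Qed.

Lemma cells_kernel_transposed : standard_kernel dd (transposed kk) A s delta.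
Proof.
have := cut_standard_kernel c (real_kernel_flip rk) eps0.
rewrite (_ : (fun i j => cut (fun x y => u y x) eps (c i) (c j)) = transposed kk) //.
by apply/funext => i; apply/funext => j; rewrite /transposed /kk /cut pdist_sym.
Qed.

(** Close to the truncation radius a pair and the corresponding centres may be cut differently, and
    only the supremum of the kernel is available; from distance [2 * eps] on neither is cut, and
    smoothness applies. *)
Lemma cut_near_le i j x y : P i x -> P j y ->
  `|cut u eps x y - kk i j| <= err i j.
Proof.
move=> /Pc ix /Pc jy; rewrite /err.
case: (ltP (dd i j)) => [_|dij]; rewrite ?mulr1 ?mulr0 ?add0r.
  apply: le_trans (ler_normB _ _) _.
  have := cut_le rk eps0 x y; have := cut_le rk eps0 (c i) (c j).
  rewrite -/M /kk; have := theta0; lra.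
have {}dij : 2 * eps <= mdist (c i) (c j).
  by move: dij; rewrite /dd; case: (leP (mdist (c i) (c j)) eps) => // _; have := eps0; lra.
have t1 := pdist_triangle (c i) x (c j).
have t2 := pdist_triangle x y (c j).
have t3 := pdist_triangle (c i) y (c j).
rewrite (pdist_sym y (c j)) in t2 t3.
have h1 : eps <= mdist (x : X) y by have := t4; have := eps0; lra.
have h2 : eps <= mdist (c i) (y : X) by have := t4; have := eps0; lra.
rewrite /kk /cut h1 ifT; last by have := eps0; lra.
apply: (kernel_near_le rk t0) => //; first by have := t0; have := t4; lra.
  by rewrite pdist_sym ltW.
by rewrite pdist_sym ltW.
Qed.

Lemma cut_op_near_le f i x : summable_fun eta f -> P i x ->
  `|cut_op u eps eta f x - \sum_j kk i j * \int[eta]_y (\1_(P j) y * f y)|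
  <= \sum_j err i j * \int[eta]_y (\1_(P j) y * `|f y|)
     + M * \int[eta]_y (\1_Z y * `|f y|).
Proof.
move=> sf Pix.
have saf := summable_norm sf.
have s1 j : summable_fun eta (fun y => \1_(P j) y * f y) by exact: summable_indic.
have s2 j : summable_fun eta (fun y => \1_(P j) y * `|f y|).
  exact: (summable_indic _ saf).
have s3 : summable_fun eta (fun y => \1_Z y * `|f y|).
  exact: summable_indic measurable_rest saf.
have s4 : summable_fun eta (fun y => \sum_j kk i j * (\1_(P j) y * f y)).
  by apply: summable_sum => j; exact: summableZ.
have s5 : summable_fun eta (fun y => \sum_j err i j * (\1_(P j) y * `|f y|)).
  by apply: summable_sum => j; exact: summableZ.
have sc := summable_cut rk eps0 sepX x sf.
have -> : \sum_j kk i j * \int[eta]_y (\1_(P j) y * f y)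
    = \int[eta]_y (\sum_j kk i j * (\1_(P j) y * f y)).
  rewrite Rint_sum; first by apply: eq_bigr => j _; rewrite RintZ.
  by move=> j; exact: summableZ.
have -> : \sum_j err i j * \int[eta]_y (\1_(P j) y * `|f y|)
    = \int[eta]_y (\sum_j err i j * (\1_(P j) y * `|f y|)).
  rewrite Rint_sum; first by apply: eq_bigr => j _; rewrite RintZ.
  by move=> j; exact: summableZ.
rewrite -RintZ // -RintD //; last exact: summableZ.
rewrite /cut_op -RintegralB //.
apply: le_norm_Rint => [||y].
- by apply: measurable_funB; [exact: summable_measurable sc|exact: summable_measurable s4].
- by apply: summableD => //; exact: summableZ.
have e1 : \sum_j kk i j * (\1_(P j) y * f y) = \sum_j \1_(P j) y * (kk i j * f y).
  by apply: eq_bigr => j _; rewrite mulrCA.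
have e2 : \sum_j err i j * (\1_(P j) y * `|f y|)
    = \sum_j \1_(P j) y * (err i j * `|f y|).
  by apply: eq_bigr => j _; rewrite mulrCA.
rewrite e1 e2; case: (cell_or_rest y) => [[j Pjy]|Zy].
  rewrite !(cell_sum_in _ Pjy) (rest_indic_in Pjy) mul0r mulr0 addr0 -mulrBl.
  by rewrite normrM ler_wpM2r // cut_near_le.
rewrite !cell_sum_out // subr0 add0r indicE mem_set // mul1r.
by rewrite normrM ler_wpM2r // (cut_le rk eps0).
Qed.

(** The supremum [A / eps^s] of the kernel meets a ball of mass at most [2^s (2 eps)^s], so [eps]
    cancels; the 1 is the smooth error, made small by the choice of [t]. *)
Definition schur_const : R := 2 * A * 4 `^ s + 1.

Hypothesis theta1 : theta * total <= 1.

Lemma schur_const_gt0 : 0 < schur_const.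
Proof. by rewrite addr_gt0 // !mulr_gt0 // powR_gt0. Qed.

Lemma err_row i : \sum_j err i j * m j <= schur_const.
Proof.
rewrite /err; under eq_bigr do rewrite mulrDl -mulrA.
rewrite big_split /= -!big_distrr /=; apply: lerD; last first.
  by apply: le_trans theta1; rewrite ler_wpM2l // mass_total.
have -> : \sum_j (dd i j < 2 * eps)%R%:R * m j = mass m (dball dd i (2 * eps)).
  rewrite /mass [RHS]big_mkcond /=; apply: eq_bigr => j _.
  by rewrite /dball /=; case: ifP => _; rewrite ?mul1r ?mul0r.
have e20 : 0 < 2 * eps by rewrite mulr_gt0.
apply: le_trans (ler_wpM2l _ (gs_growth cells_growth i e20)) _.
  by rewrite mulr_ge0 // ltW.
have -> : 4 `^ s = 2 `^ s * 2 `^ s :> R by rewrite -powRM //; congr (_ `^ _); ring.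
rewrite /M powRM ?ler0n ?(ltW eps0) // le_eqVlt; apply/orP; left; apply/eqP.
by field; rewrite gt_eqF // powR_gt0.
Qed.

Variable C : R.
Hypothesis C0 : 0 <= C.
Hypothesis restricted : forall Q : set (borel X), measurable Q ->
  \int[eta]_x (\1_Q x * cut_op u eps eta \1_Q x ^+ 2) <= C * fine (eta Q).

(** The hypothesis is tested on the union of the cells in [S]. The L^1 form follows from
    [|T| <= 1 + T^2], and [schur_const] bounds the difference between [T] and the model on each
    cell. *)
Lemma cells_restricted (S : pred 'I_n) :
  \sum_(i | S i) m i * `|kint kk m S i| <= (C + (1 + schur_const)) * mass m S.
Proof.
pose Q : set (borel X) := [set x | exists2 j, S j & P j x].
have mQ : measurable Q.
  have -> : Q = \bigcup_(j in [set j | S j]) P j.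
    by apply/seteqP; split => x [j Sj Pj]; exists j.
  by apply: fin_bigcup_measurable.
have Qin i x : P i x -> (\1_Q x : R) = (S i)%:R.
  move=> Pix; rewrite indicE; case: (boolP (S i)) => Si.
    by rewrite mem_set //; exists i.
  rewrite memNset // => -[j Sj Pjx].
  by rewrite (Pinj Pix Pjx) Sj in Si.
have Qout x : Z x -> (\1_Q x : R) = 0.
  by move=> Zx; rewrite indicE memNset // => -[j _ /Zx].
have Fj j : \int[eta]_y (\1_(P j) y * \1_Q y) = (S j)%:R * m j.
  rewrite /m -Rint_indic // -RintZ; last exact: summable_indic1.
  apply: eq_Rintegral => y _; rewrite [in LHS]indicE [in RHS]indicE.
  case: (boolP (y \in P j)) => [|_]; last by rewrite mul0r mulr0.
  by rewrite inE => /Qin ->; rewrite mul1r mulr1.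
have sQ : summable_fun eta (\1_Q : borel X -> R) by exact: summable_indic1.
pose T := cut_op u eps eta \1_Q.
have Tbound i x : P i x -> `|kint kk m S i| <= `|T x| + schur_const.
  move=> Pix; have := cut_op_near_le sQ Pix.
  have nQ y : `|\1_Q y : R| = \1_Q y.
    by rewrite ger0_norm //; case/andP: (indic01 (R := R) Q y).
  under [X in M * X]eq_Rintegral do rewrite nQ.
  have -> : \int[eta]_y (\1_Z y * \1_Q y) = 0.
    rewrite (@eq_Rintegral _ _ _ eta setT (fun=> 0)).
      by rewrite Rintegral_cst // mul0r.
    move=> y _; case: (cell_or_rest y) => [[j Pj]|Zy].
      by rewrite (rest_indic_in Pj) mul0r.
    by rewrite Qout // mulr0.
  rewrite mulr0 addr0.
  have -> : \sum_j kk i j * \int[eta]_y (\1_(P j) y * \1_Q y) = kint kk m S i.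
    rewrite /kint [RHS]big_mkcond /=; apply: eq_bigr => j _; rewrite Fj.
    by case: (S j); rewrite ?mul1r ?mul0r ?mulr0.
  have : \sum_j err i j * \int[eta]_y (\1_(P j) y * `|\1_Q y|) <= schur_const.
    apply: le_trans (err_row i); apply: ler_sum => j _.
    under eq_Rintegral do rewrite nQ.
    rewrite Fj ler_wpM2l // -[leRHS]mul1r ler_wpM2r ?cell_mass_ge0 //.
    by case: (S j).
  rewrite -/T; have := ler_normB (T x) (T x - kint kk m S i).
  rewrite subKr; lra.
have mT : measurable_fun setT T.
  by apply: measurable_cut_op rk eps0 _ sepX _ _; exact: measurable_indicT.
have Tb x : `|T x| <= M * total.
  rewrite /total -Rintegral_cst //; apply: le_norm_Rint => [||y].
  - by apply: summable_measurable (summable_cut rk eps0 sepX x sQ).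
  - exact: summable_cst.
  rewrite normrM -[leRHS]mulr1.
  by apply: ler_pM => //; [exact: (cut_le rk eps0)|exact: norm_indic_le1].
have sT2 : summable_fun eta (fun x => T x ^+ 2).
  apply: (@summable_bounded _ _ _ eta ((M * total) ^+ 2)).
    exact: measurable_funX.
  move=> x; rewrite normrX lerXn2r // nnegrE.
  by rewrite (le_trans _ (Tb x)).
have sPT i : summable_fun eta (fun x => \1_(P i) x * T x ^+ 2) by exact: summable_indic.
have term i : m i * `|kint kk m S i|
    <= (1 + schur_const) * m i + \int[eta]_x (\1_(P i) x * T x ^+ 2).
  rewrite mulrC /m -Rint_indic // -!RintZ; [|exact: summable_indic1..].
  rewrite -RintD //; last by apply: summableZ; exact: summable_indic1.
  apply: le_Rint => [||x].
  - by apply: summableZ; exact: summable_indic1.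
  - by apply: summableD => //; apply: summableZ; exact: summable_indic1.
  rewrite [X in _ * X]indicE [X in _ <= _ * X + _]indicE [X in _ + X * _]indicE.
  case: (boolP (x \in P i)) => [|_]; last by rewrite !mulr0 mul0r addr0.
  rewrite inE => /Tbound h; rewrite !mulr1 mul1r; apply: le_trans h _.
  rewrite -(real_normK (num_real (T x))).
  have := sqr_ge0 (`|T x| - 1); have := normr_ge0 (T x); nra.
apply: (@le_trans _ _ (\sum_(i | S i) ((1 + schur_const) * m i
    + \int[eta]_x (\1_(P i) x * T x ^+ 2)))).
  by apply: ler_sum => i _.
rewrite big_split /= -big_distrr /= -/(mass m S) [leRHS]mulrDl addrC lerD2r.
have -> : mass m S = fine (eta Q).
  have -> : mass m S = \sum_j \int[eta]_y (\1_(P j) y * \1_Q y).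
    rewrite /mass big_mkcond; apply: eq_bigr => j _; rewrite Fj.
    by case: (S j); rewrite ?mul1r ?mul0r.
  rewrite -Rint_sum; last by move=> j; apply: summable_indic.
  rewrite -Rint_indic //; apply: eq_Rintegral => y _.
  case: (cell_or_rest y) => [[j Pj]|Zy].
    by rewrite (cell_sum_in (fun=> \1_Q y) Pj).
  by rewrite (cell_sum_out (fun=> \1_Q y) Zy) Qout.
apply: le_trans (restricted mQ).
rewrite big_mkcond /=.
have e i : (if S i then \int[eta]_x (\1_(P i) x * T x ^+ 2) else 0)
    = \int[eta]_x ((S i)%:R * (\1_(P i) x * T x ^+ 2)).
  by rewrite RintZ //; case: (S i); rewrite ?mul1r ?mul0r.
under eq_bigr do rewrite e.
have sSPT i : summable_fun eta (fun x => (S i)%:R * (\1_(P i) x * T x ^+ 2)).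
  exact: summableZ.
rewrite -Rint_sum //; apply: le_Rint => [||x].
- exact: summable_sum.
- exact: summable_indic.
under eq_bigr do rewrite mulrCA.
case: (cell_or_rest x) => [[j Pj]|Zx].
  by rewrite (cell_sum_in _ Pj) (Qin _ _ Pj).
by rewrite cell_sum_out // Qout // mul0r.
Qed.

(** The factors 3 come from squaring a sum of three terms. The final 1 pays for the uncovered rest:
    three quarters for its effect on the cells, one quarter for the values taken on it. *)
Definition real_const : R :=
  3 * discrete_const A (2 `^ s) s delta (C + (1 + schur_const))
  + 12 * schur_const ^+ 2 + 1.

Hypothesis rest_small : 4 * M ^+ 2 * total * fine (eta Z) <= 1.

Lemma cells_L2 (f : borel X -> R) : measurable_fun setT f ->
  summable_fun eta (fun x => f x ^+ 2) ->
  \int[eta]_x (cut_op u eps eta f x ^+ 2)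
    <= real_const * \int[eta]_x (f x ^+ 2).
Proof.
move=> mf sf2.
have sf := summable_sqr mf sf2.
pose T := cut_op u eps eta f.
pose F j := \int[eta]_y (\1_(P j) y * f y).
pose Phi j := \int[eta]_y (\1_(P j) y * `|f y|).
pose PhiZ := \int[eta]_y (\1_Z y * `|f y|).
pose N2 := \int[eta]_y (f y ^+ 2).
have saf := summable_norm sf.
have N20 : 0 <= N2 by apply: Rintegral_ge0 => x _; exact: sqr_ge0.
have Phi0 j : 0 <= Phi j by apply: Rintegral_ge0 => y _; rewrite mulr_ge0.
have PhiZ0 : 0 <= PhiZ by apply: Rintegral_ge0 => y _; rewrite mulr_ge0.
have FPhi j : `|F j| <= Phi j.
  apply: le_norm_Rint => [||y].
  - exact: summable_measurable (summable_indic (mP j) sf).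
  - by apply: (summable_indic _ saf).
  by rewrite normrM ler_wpM2r // ger0_norm.
pose loc j := \int[eta]_y (\1_(P j) y * f y ^+ 2).
have PhiCS j : Phi j ^+ 2 <= m j * loc j by exact: Rint_indic_sqr.
have loc0 j : 0 <= loc j.
  by apply: Rintegral_ge0 => y _; rewrite mulr_ge0 ?sqr_ge0.
have sum_loc : \sum_j loc j <= N2.
  rewrite -Rint_sum; last by move=> j; exact: summable_indic.
  apply: le_Rint => // [|y].
    by apply: summable_sum => j; exact: summable_indic.
  case: (cell_or_rest y) => [[j Pj]|Zy].
    by rewrite (cell_sum_in (fun=> f y ^+ 2) Pj).
  by rewrite (cell_sum_out (fun=> f y ^+ 2) Zy) sqr_ge0.
have total0 : 0 <= total by exact: fine_ge0.
have restCS : PhiZ ^+ 2 <= fine (eta Z) * N2.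
  apply: le_trans (Rint_indic_sqr measurable_rest mf sf2) _.
  rewrite ler_wpM2l ?fine_ge0 //; apply: le_Rint => // [|y].
    exact: summable_indic measurable_rest sf2.
  by rewrite ler_piMl ?sqr_ge0.
pose W := \int[eta]_y `|f y|.
have WCS : W ^+ 2 <= total * N2.
  have := Rint_indic_sqr (mu := eta) measurableT mf sf2.
  rewrite (@eq_Rintegral _ _ _ eta setT (fun y => `|f y|)); last first.
    by move=> y _; rewrite indicT mul1r.
  rewrite [X in _ * X](@eq_Rintegral _ _ _ eta setT (fun y => f y ^+ 2)) //.
  by move=> y _; rewrite indicT mul1r.
have Wb x : `|T x| <= M * W.
  rewrite -RintZ //; apply: le_norm_Rint => [||y].
  - by apply: summable_measurable (summable_cut rk eps0 sepX x sf).
  - exact: summableZ.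
  by rewrite normrM ler_wpM2r // (cut_le rk eps0).
(* Averages over the cells; on a null cell the quotient is 0 by convention, consistently with the
   vanishing of [F] and [Phi] there. *)
pose fj j := F j / m j; pose hj j := Phi j / m j.
have Phi_null j : m j = 0 -> Phi j = 0.
  move=> mj; have := PhiCS j; rewrite mj mul0r => h.
  by apply/eqP; rewrite -sqrf_eq0 eq_le h sqr_ge0.
have F_null j : m j = 0 -> F j = 0.
  by move=> /Phi_null h; apply/eqP; rewrite -normr_le0 (le_trans (FPhi j)) ?h.
have mfj j : m j * fj j = F j.
  rewrite /fj; case: (eqVneq (m j) 0) => [/[dup]/F_null -> ->|mj].
    by rewrite !mul0r.
  by rewrite mulrC divfK.
have mhj j : m j * hj j = Phi j.
  rewrite /hj; case: (eqVneq (m j) 0) => [/[dup]/Phi_null -> ->|mj].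
    by rewrite !mul0r.
  by rewrite mulrC divfK.
have hsq j : m j * hj j ^+ 2 <= loc j.
  rewrite expr2 mulrA mhj /hj; case: (eqVneq (m j) 0) => [mj|mj].
    by rewrite mj invr0 mulr0 mulr0.
  have mj0 : 0 < m j by rewrite lt_def mj cell_mass_ge0.
  by rewrite mulrA -expr2 ler_pdivrMr // mulrC.
have nh : sqnorm m hj <= N2.
  by apply: le_trans sum_loc; apply: ler_sum => j _; exact: hsq.
have nf : sqnorm m fj <= N2.
  apply: le_trans nh; apply: ler_sum => j _; rewrite ler_wpM2l ?cell_mass_ge0 //.
  rewrite -(real_normK (num_real (fj j))) lerXn2r ?nnegrE //.
    by rewrite divr_ge0 ?cell_mass_ge0.
  by rewrite /fj /hj normrM normfV (ger0_norm (cell_mass_ge0 j)) ler_wpM2r ?invr_ge0 ?cell_mass_ge0.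
(* On the cell [i] the operator equals [a i] up to [b i + e]: the model applied to the averages of
   [f], the error kernel applied to those of [|f|], and the contribution of the rest. *)
pose a i := kapply m kk fj i; pose b i := kapply m err hj i.
have aE i : a i = \sum_j kk i j * F j.
  by apply: eq_bigr => j _; rewrite -mulrA mfj.
have bE i : b i = \sum_j err i j * Phi j.
  by apply: eq_bigr => j _; rewrite -mulrA mhj.
have Sc := schur_const_gt0.
have na : sqnorm m a <= discrete_const A (2 `^ s) s delta (C + (1 + schur_const)) * N2.
  apply: le_trans (discrete_T1 cells_growth cells_kernel cells_kernel_transposed
    _ cells_restricted fj) _.
    by have := C0; lra.
  by rewrite ler_wpM2l // /discrete_const mulr_ge0 // sqr_ge0.
have nb : sqnorm m b <= 4 * schur_const ^+ 2 * N2.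
  apply: (@le_trans _ _ (4 * schur_const ^+ 2 * sqnorm m hj)).
    apply: sqnorm_kapply_le => //; first exact: cell_mass_ge0.
    move=> g; apply: schur_bound => //.
    + exact: cell_mass_ge0.
    + exact: ltW.
    + by move=> i j; rewrite /err /dd pdist_sym.
    + exact: err_row.
  by rewrite ler_wpM2l // mulr_ge0 // sqr_ge0.
pose e := M * PhiZ.
have mT : measurable_fun setT T by exact: measurable_cut_op rk eps0 _ sepX _ mf.
have sT2 : summable_fun eta (fun x => T x ^+ 2).
  apply: (@summable_bounded _ _ _ eta ((M * W) ^+ 2)).
    exact: measurable_funX.
  move=> x; rewrite normrX lerXn2r // nnegrE.
  by rewrite (le_trans _ (Wb x)).
pose tt i := 3 * (a i ^+ 2 + b i ^+ 2 + e ^+ 2).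
have Tcell i x : P i x -> T x ^+ 2 <= tt i.
  move=> Pix; have h : `|T x - a i| <= b i + e.
    by rewrite aE bE; exact: cut_op_near_le.
  have hT : `|T x| <= `|a i| + b i + e.
    have := ler_normD (T x - a i) (a i); rewrite subrK.
    by move: h; set y := `|_ - _|; lra.
  apply: (@le_trans _ _ ((`|a i| + b i + e) ^+ 2)).
    rewrite -(real_normK (num_real (T x))) lerXn2r ?nnegrE //.
    exact: le_trans hT.
  rewrite /tt -(real_normK (num_real (a i))).
  have := sqr_ge0 (`|a i| - b i); have := sqr_ge0 (`|a i| - e).
  have := sqr_ge0 (b i - e); set y := `|a i|; set z := b i; rewrite !expr2; lra.
(* On the rest only the crude bound [M * W] is available; the small measure of [Z] compensates for
   it. *)
have ptw x : T x ^+ 2 <= \sum_i \1_(P i) x * tt i + (M * W) ^+ 2 * \1_Z x.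
  case: (cell_or_rest x) => [[i Pix]|Zx].
    by rewrite (cell_sum_in _ Pix) (rest_indic_in Pix) mulr0 addr0 Tcell.
  rewrite cell_sum_out // add0r indicE mem_set // mulr1.
  rewrite -(real_normK (num_real (T x))) lerXn2r ?nnegrE //.
  by rewrite (le_trans _ (Wb x)).
have stt i : summable_fun eta (fun x => \1_(P i) x * tt i).
  under eq_fun do rewrite mulrC.
  by apply: summableZ; exact: summable_indic1.
have sZ : summable_fun eta (\1_Z : borel X -> R).
  exact: summable_indic1 measurable_rest.
have main : \int[eta]_x (T x ^+ 2) <= \sum_i m i * tt i + (M * W) ^+ 2 * fine (eta Z).
  have -> : \sum_i m i * tt i = \int[eta]_x (\sum_i \1_(P i) x * tt i).
    rewrite Rint_sum //; apply: eq_bigr => i _.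
    under eq_Rintegral do rewrite mulrC.
    by rewrite RintZ ?Rint_indic 1?mulrC //; exact: summable_indic1.
  rewrite -Rint_indic; last exact: measurable_rest.
  rewrite -RintZ // -RintD //; [|exact: summable_sum|exact: summableZ].
  apply: le_Rint => //; apply: summableD; [exact: summable_sum|exact: summableZ].
apply: le_trans main _.
have -> : \sum_i m i * tt i
    = 3 * (sqnorm m a + sqnorm m b + e ^+ 2 * \sum_i m i).
  rewrite /sqnorm [e ^+ 2 * _]big_distrr -!big_split /= big_distrr /=.
  by apply: eq_bigr => i _; rewrite /tt; ring.
have e2 : e ^+ 2 * \sum_i m i <= M ^+ 2 * total * fine (eta Z) * N2.
  apply: (@le_trans _ _ ((M ^+ 2 * (fine (eta Z) * N2)) * total)).
    apply: ler_pM; rewrite ?sqr_ge0 ?mass_total //.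
      by apply: sumr_ge0 => i _; exact: cell_mass_ge0.
    by rewrite /e exprMn ler_wpM2l ?sqr_ge0.
  by rewrite le_eqVlt; apply/orP; left; apply/eqP; ring.
have w2 : (M * W) ^+ 2 * fine (eta Z) <= M ^+ 2 * total * fine (eta Z) * N2.
  have -> : M ^+ 2 * total * fine (eta Z) * N2
      = M ^+ 2 * (total * N2) * fine (eta Z) by ring.
  by rewrite ler_wpM2r ?fine_ge0 // exprMn ler_wpM2l ?sqr_ge0.
have rs := ler_wpM2r N20 rest_small.
rewrite mul1r in rs.
rewrite /real_const -/N2; lra.
Qed.

End Cells.
End Discretization.

(** * Real kernels on a separable metric space *)

Section RealT1.
Context {R : realType} {X : pmetricType R}.

(** The cells depend on [eps] and on the total mass of [eta], but these enter only the choice of [t]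
    and of the admissible rest, not the final constant. *)
Lemma real_T1 (u : X -> X -> R) (A s delta eps C : R)
    (eta : {finite_measure set (borel X) -> \bar R}) :
  real_kernel u A s delta -> 0 < eps -> separable X -> Sigma s eta -> 0 <= C ->
  (forall Q : set (borel X), measurable Q ->
    \int[eta]_x (\1_Q x * cut_op u eps eta \1_Q x ^+ 2) <= C * fine (eta Q)) ->
  forall f : borel X -> R, measurable_fun setT f ->
    summable_fun eta (fun x => f x ^+ 2) ->
    \int[eta]_x (cut_op u eps eta f x ^+ 2)
      <= real_const A s delta C * \int[eta]_x (f x ^+ 2).
Proof.
move=> rk eps0 sepX sig C0 restr f mf sf.
have A0 := rk_const rk; have s0 := rk_exp rk; have delta0 := rk_delta rk.
pose total := fine (eta setT); have total0 : 0 <= total by exact: fine_ge0.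
pose b := 2 * A / eps `^ (s + delta) * total + 1.
have b0 : 0 < b.
  by rewrite ltr_wpDl // !mulr_ge0 ?invr_ge0 ?powR_ge0 // ltW.
pose t := Num.min (eps / 4) (b^-1 `^ delta^-1).
have t0 : 0 < t by rewrite lt_min divr_gt0 //= powR_gt0 // invr_gt0.
have t4 : 4 * t <= eps.
  have : t <= eps / 4 by rewrite ge_min lexx.
  lra.
have tb : t `^ delta <= b^-1.
  apply: (@le_trans _ _ ((b^-1 `^ delta^-1) `^ delta)).
    by rewrite powR_monor ?(ltW delta0) ?(ltW t0) // ge_min lexx orbT.
  by rewrite -powRrM mulVf ?gt_eqF // powRr1 // invr_ge0 ltW.
have theta1 : 2 * A * (t `^ delta / eps `^ (s + delta)) * total <= 1.
  have -> : 2 * A * (t `^ delta / eps `^ (s + delta)) * total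
      = t `^ delta * (2 * A / eps `^ (s + delta) * total) by ring.
  apply: (@le_trans _ _ (b^-1 * b)); last by rewrite mulVf ?gt_eqF.
  apply: ler_pM; rewrite ?powR_ge0 //; last by rewrite /b lerDl.
  by rewrite !mulr_ge0 ?invr_ge0 ?powR_ge0 // ltW.
(* The factor of the measure of the rest in the smallness condition; a rest of measure at most
   [1 / (w + 1)] satisfies it. *)
pose w := 4 * (A / eps `^ s) ^+ 2 * total.
have w0 : 0 <= w by rewrite mulr_ge0 // mulr_ge0 ?sqr_ge0.
have z0 : 0 < (w + 1)^-1 by rewrite invr_gt0 ltr_wpDl.
have [n [c [P [mP Pc Pinj Pz]]]] := exists_cells eta sepX t0 z0.
apply: (cells_L2 rk eps0 sepX sig t0 t4 mP Pc Pinj theta1 C0 restr) => //.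
apply: le_trans (ler_wpM2l w0 Pz) _.
by rewrite -/w ler_pdivrMr ?ltr_wpDl // mul1r lerDl.
Qed.

End RealT1.

(** * Complex kernels *)

Section ComplexParts.
Context {R : realType}.
Implicit Types z w : R[i].

Lemma sqr_cabs z : cabs z ^+ 2 = complex.Re z ^+ 2 + complex.Im z ^+ 2.
Proof. by case: z => a b /=; rewrite sqr_sqrtr // addr_ge0 ?sqr_ge0. Qed.

Lemma cabs_ge0 z : 0 <= cabs z.
Proof. by case: z => a b /=; exact: sqrtr_ge0. Qed.

Lemma Re_le_cabs z : `|complex.Re z| <= cabs z.
Proof.
by case: z => a b /=; rewrite -sqrtr_sqr ler_wsqrtr // lerDl sqr_ge0.
Qed.

Lemma Im_le_cabs z : `|complex.Im z| <= cabs z.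
Proof.
by case: z => a b /=; rewrite -sqrtr_sqr ler_wsqrtr // lerDr sqr_ge0.
Qed.

Lemma complex_ReB z w : complex.Re (z - w) = complex.Re z - complex.Re w.
Proof. by case: z => a b; case: w. Qed.

Lemma complex_ImB z w : complex.Im (z - w) = complex.Im z - complex.Im w.
Proof. by case: z => a b; case: w. Qed.

Lemma complex_ReM z w : complex.Re (z * w)
  = complex.Re z * complex.Re w - complex.Im z * complex.Im w.
Proof. by case: z => a b; case: w. Qed.

Lemma complex_ImM z w : complex.Im (z * w)
  = complex.Re z * complex.Im w + complex.Im z * complex.Re w.
Proof. by case: z => a b; case: w. Qed.

End ComplexParts.

Section ComplexKernel.
Context {R : realType} {X : pmetricType R}.
Variables (K : X -> X -> R[i]) (A s delta : R).
Hypothesis cz : CZ_kernel A s delta K.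

Lemma CZ_kernel_Re : real_kernel (fun x y => complex.Re (K x y)) A s delta.
Proof.
case: cz => A0 s0 /andP[d0 _] size smooth; split => // [x y xy|x x' y xy h|x x' y xy h].
- exact: le_trans (Re_le_cabs _) (size _ _ xy).
- rewrite -complex_ReB; apply: le_trans (Re_le_cabs _) _.
  by have [] := smooth x x' y xy h.
- rewrite -complex_ReB; apply: le_trans (Re_le_cabs _) _.
  by have [] := smooth x x' y xy h.
Qed.

Lemma CZ_kernel_Im : real_kernel (fun x y => complex.Im (K x y)) A s delta.
Proof.
case: cz => A0 s0 /andP[d0 _] size smooth; split => // [x y xy|x x' y xy h|x x' y xy h].
- exact: le_trans (Im_le_cabs _) (size _ _ xy).
- rewrite -complex_ImB; apply: le_trans (Im_le_cabs _) _.
  by have [] := smooth x x' y xy h.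
- rewrite -complex_ImB; apply: le_trans (Im_le_cabs _) _.
  by have [] := smooth x x' y xy h.
Qed.

End ComplexKernel.

Section TruncatedParts.
Context {R : realType} {X : pmetricType R}.
Variables (K : X -> X -> R[i]) (A s delta eps : R).
Hypothesis cz : CZ_kernel A s delta K.
Hypothesis eps0 : 0 < eps.
Hypothesis sepX : separable X.
Variable eta : {finite_measure set (borel X) -> \bar R}.

Let u1 x y := complex.Re (K x y).
Let u2 x y := complex.Im (K x y).
Let rk1 : real_kernel u1 A s delta := CZ_kernel_Re cz.
Let rk2 : real_kernel u2 A s delta := CZ_kernel_Im cz.

Lemma Rint_compl_ball (g : borel X -> R) (x : X) :
  \int[eta]_(y in ~` ball x eps) g y
  = \int[eta]_y (if eps <= mdist x y then g y else 0).
Proof.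
rewrite Rintegral_mkcond; apply: eq_Rintegral => y _; rewrite patchE ballEmdist.
case: (leP eps) => xy; first by rewrite mem_set //= ltNge xy.
by rewrite memNset //=; apply: contrapT => h; apply: h.
Qed.

Lemma Re_truncated_op (f : borel X -> R[i]) x :
  summable_fun eta (fun y => complex.Re (f y)) ->
  summable_fun eta (fun y => complex.Im (f y)) ->
  complex.Re (truncated_op K eta eps f x)
  = cut_op u1 eps eta (fun y => complex.Re (f y)) x
  - cut_op u2 eps eta (fun y => complex.Im (f y)) x.
Proof.
move=> s1 s2; rewrite /truncated_op /cintegral /= Rint_compl_ball /cut_op.
rewrite -RintegralB //.
- apply: eq_Rintegral => y _; rewrite complex_ReM /cut.
  by case: ifP => _; rewrite ?mul0r ?subrr.
- exact: (summable_cut rk1 eps0 sepX x s1).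
- exact: (summable_cut rk2 eps0 sepX x s2).
Qed.

Lemma Im_truncated_op (f : borel X -> R[i]) x :
  summable_fun eta (fun y => complex.Re (f y)) ->
  summable_fun eta (fun y => complex.Im (f y)) ->
  complex.Im (truncated_op K eta eps f x)
  = cut_op u1 eps eta (fun y => complex.Im (f y)) x
  + cut_op u2 eps eta (fun y => complex.Re (f y)) x.
Proof.
move=> s1 s2; rewrite /truncated_op /cintegral /= Rint_compl_ball /cut_op.
rewrite -RintD.
- apply: eq_Rintegral => y _; rewrite complex_ImM /cut.
  by case: ifP => _; rewrite ?mul0r ?addr0.
- exact: (summable_cut rk1 eps0 sepX x s2).
- exact: (summable_cut rk2 eps0 sepX x s1).
Qed.

End TruncatedParts.

Section ComplexL2.
Context {disp : measure_display} {T : measurableType disp} {R : realType}.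

Lemma L2normE (mu : {measure set T -> \bar R}) (f : T -> R[i]) :
  L2norm mu f = ((\int[mu]_x (cabs (f x) ^+ 2)%:E) `^ 2^-1)%E.
Proof.
rewrite /L2norm Lnorm.unlock; congr (_ `^ _)%E; apply: eq_integral => x _.
by rewrite abse_EFin ger0_norm ?cabs_ge0 // poweR_EFin powR_mulrn ?cabs_ge0.
Qed.

Lemma L2norm_sqr (mu : {measure set T -> \bar R}) (f : T -> R[i]) :
  (L2norm mu f ^+ 2 = \int[mu]_x (cabs (f x) ^+ 2)%:E)%E.
Proof.
rewrite L2normE.
have : (0 <= \int[mu]_x (cabs (f x) ^+ 2)%:E)%E.
  by apply: integral_ge0 => x _; rewrite lee_fin sqr_ge0.
case: (\int[mu]_x _)%E => [r| |] // r0.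
  rewrite poweR_EFin -EFin_expe; congr (_%:E).
  by rewrite powR12_sqrt // sqr_sqrtr.
by rewrite poweRyr ?invr_eq0 ?pnatr_eq0 // expe2 mulyy.
Qed.

Variable mu : {finite_measure set T -> \bar R}.

Lemma measurable_cabs_sqr (f : T -> R[i]) : cmeasurable f ->
  measurable_fun setT (fun x => cabs (f x) ^+ 2).
Proof.
move=> [m1 m2]; under eq_fun do rewrite sqr_cabs.
by apply: measurable_funD; exact: measurable_funX.
Qed.

Lemma inL2P (f : T -> R[i]) : cmeasurable f ->
  inL2 mu f <-> summable_fun mu (fun x => cabs (f x) ^+ 2).
Proof.
move=> mf; have e : (\int[mu]_x `|(cabs (f x) ^+ 2)%:E|
    = \int[mu]_x (cabs (f x) ^+ 2)%:E)%E.
  by apply: eq_integral => x _; rewrite gee0_abs // lee_fin sqr_ge0.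
split => [[_]|/integrableP[_]].
  rewrite L2normE => /lty_poweRy h; apply/integrableP; split.
    by apply/measurable_EFinP; exact: measurable_cabs_sqr.
  by rewrite /= e h // invr_eq0 pnatr_eq0.
by rewrite /= e => h; split => //; rewrite L2normE poweR_lty.
Qed.

Lemma L2norm_summable (f : T -> R[i]) :
  summable_fun mu (fun x => cabs (f x) ^+ 2) ->
  L2norm mu f = (Num.sqrt (\int[mu]_x (cabs (f x) ^+ 2)))%:E.
Proof.
move=> sf; rewrite L2normE.
have -> : (\int[mu]_x (cabs (f x) ^+ 2)%:E)%E
    = (\int[mu]_x (cabs (f x) ^+ 2))%:E.
  by rewrite /Rintegral fineK //; exact: integrable_fin_num.
by rewrite poweR_EFin powR12_sqrt // Rintegral_ge0 // => x _; exact: sqr_ge0.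
Qed.

Lemma summable_Re_sqr (f : T -> R[i]) : cmeasurable f ->
  summable_fun mu (fun x => cabs (f x) ^+ 2) ->
  summable_fun mu (fun x => complex.Re (f x) ^+ 2).
Proof.
move=> [m1 _]; apply: summable_dom; first exact: measurable_funX.
by move=> x; rewrite !ger0_norm ?sqr_ge0 // sqr_cabs lerDl sqr_ge0.
Qed.

Lemma summable_Im_sqr (f : T -> R[i]) : cmeasurable f ->
  summable_fun mu (fun x => cabs (f x) ^+ 2) ->
  summable_fun mu (fun x => complex.Im (f x) ^+ 2).
Proof.
move=> [_ m2]; apply: summable_dom; first exact: measurable_funX.
by move=> x; rewrite !ger0_norm ?sqr_ge0 // sqr_cabs lerDr sqr_ge0.
Qed.

Lemma le_integral_mrestr (Q : set T) (mQ : measurable Q) (g : T -> R) :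
  measurable_fun setT g -> (forall x, 0 <= g x) ->
  (\int[mu]_(x in Q) (g x)%:E <= \int[mrestr mu mQ]_x (g x)%:E)%E.
Proof.
move=> mg g0.
rewrite (@eq_measure_integral _ _ _ Q (mrestr mu mQ) mu); last first.
  by move=> B mB BQ; rewrite /= /mrestr setIidl.
apply: ge0_subset_integral => //; first exact/measurable_EFinP.
by move=> x _; rewrite lee_fin.
Qed.

End ComplexL2.

Section ComplexT1.
Context {R : realType} {X : pmetricType R}.
Variables (K : X -> X -> R[i]) (A s delta eps C : R).
Variable eta : {finite_measure set (borel X) -> \bar R}.
Hypothesis cz : CZ_kernel A s delta K.
Hypothesis eps0 : 0 < eps.
Hypothesis sepX : separable X.
Hypothesis sig : Sigma s eta.
Hypothesis restricted : forall (Q : set (borel X)) (mQ : measurable Q),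
  (L2norm (mrestr eta mQ) (truncated_op K eta eps \1_Q) ^+ 2
    <= C%:E * eta Q)%E.

Let u1 x y := complex.Re (K x y).
Let u2 x y := complex.Im (K x y).
Let rk1 : real_kernel u1 A s delta := CZ_kernel_Re cz.
Let rk2 : real_kernel u2 A s delta := CZ_kernel_Im cz.

(** As [\1_Q] is real, the real and imaginary parts of the image are the images under the two parts
    of the kernel, and each square is at most the square of the modulus. [C] may have any sign,
    hence [|C|]. *)
Lemma parts_restricted (Q : set (borel X)) : measurable Q ->
  \int[eta]_x (\1_Q x * cut_op u1 eps eta \1_Q x ^+ 2) <= `|C| * fine (eta Q) /\
  \int[eta]_x (\1_Q x * cut_op u2 eps eta \1_Q x ^+ 2) <= `|C| * fine (eta Q).
Proof.
move=> mQ.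
pose chi : borel X -> R := \1_Q.
have sQ : summable_fun eta chi by exact: summable_indic1.
have e1 : (fun y => complex.Re (\1_Q y : R[i])) = chi.
  by apply/funext => y; rewrite /chi !indicE; case: (_ \in _).
have e2 : (fun y => complex.Im (\1_Q y : R[i])) = (fun=> 0).
  by apply/funext => y; rewrite !indicE; case: (_ \in _).
have s1 : summable_fun eta (fun y => complex.Re (\1_Q y : R[i])) by rewrite e1.
have s2 : summable_fun eta (fun y => complex.Im (\1_Q y : R[i])).
  by rewrite e2; exact: summable_cst.
have op0 u x : cut_op u eps eta (fun=> 0) x = 0.
  rewrite /cut_op; under eq_Rintegral do rewrite mulr0.
  by rewrite Rintegral_cst // mul0r.
pose g1 := cut_op u1 eps eta chi; pose g2 := cut_op u2 eps eta chi.
have sqE x : cabs (truncated_op K eta eps \1_Q x) ^+ 2 = g1 x ^+ 2 + g2 x ^+ 2.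
  rewrite sqr_cabs (Re_truncated_op cz eps0 sepX x s1 s2).
  by rewrite (Im_truncated_op cz eps0 sepX x s1 s2) e1 e2 !op0 subr0 add0r.
have m1 : measurable_fun setT g1.
  by apply: measurable_cut_op rk1 eps0 _ sepX _ _; exact: summable_measurable sQ.
have m2 : measurable_fun setT g2.
  by apply: measurable_cut_op rk2 eps0 _ sepX _ _; exact: summable_measurable sQ.
pose h x := g1 x ^+ 2 + g2 x ^+ 2.
have mg : measurable_fun setT h.
  by apply: measurable_funD; exact: measurable_funX.
have g0 x : 0 <= h x by rewrite addr_ge0 ?sqr_ge0.
have bound : (\int[eta]_(x in Q) (h x)%:E
    <= (`|C| * fine (eta Q))%:E)%E.
  apply: le_trans (le_integral_mrestr eta mQ mg g0) _.
  apply: (@le_trans _ _ (C%:E * eta Q)%E).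
    apply: le_trans (restricted mQ); rewrite L2norm_sqr.
    by under [leRHS]eq_integral do rewrite sqE.
  rewrite -[in leLHS](fineK (fin_num_measure eta _ mQ)) -EFinM lee_fin.
  by rewrite ler_wpM2r ?fine_ge0 // ler_norm.
have part (g : borel X -> R) : measurable_fun setT g ->
    (forall x, g x ^+ 2 <= h x) ->
    \int[eta]_x (\1_Q x * g x ^+ 2) <= `|C| * fine (eta Q).
  move=> mg' gle; rewrite -lee_fin; apply: (le_trans _ bound).
  rewrite /Rintegral.
  have -> : (\int[eta]_x (\1_Q x * g x ^+ 2)%:E
      = \int[eta]_(x in Q) (g x ^+ 2)%:E)%E.
    rewrite [RHS]integral_mkcond; apply: eq_integral => x _.
    by rewrite patchE indicE; case: (x \in Q); rewrite ?mul1r ?mul0r.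
  have le : (\int[eta]_(x in Q) (g x ^+ 2)%:E
      <= \int[eta]_(x in Q) (h x)%:E)%E.
    apply: ge0_le_integral => //.
    - by move=> x _; rewrite lee_fin sqr_ge0.
    - apply/measurable_EFinP; apply: measurable_funTS; exact: measurable_funX.
    - by apply/measurable_EFinP; exact: measurable_funTS.
    - by move=> x _; rewrite lee_fin.
  rewrite fineK //.
  rewrite ge0_fin_numE; last by apply: integral_ge0 => x _; rewrite lee_fin sqr_ge0.
  by apply: le_lt_trans le (le_lt_trans bound _); rewrite ltry.
split; apply: part => // x.
  by rewrite /h lerDl sqr_ge0.
by rewrite /h lerDr sqr_ge0.
Qed.

(** The real and imaginary parts of the image are sums of two real images each: one factor 2 comes
    from squaring these sums, another from applying two kernels to each part of [f]. *)
Definition complex_const : R := 4 * real_const A s delta `|C|.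

Lemma truncated_op_L2 (f : borel X -> R[i]) : cmeasurable f ->
  summable_fun eta (fun x => cabs (f x) ^+ 2) ->
  [/\ cmeasurable (truncated_op K eta eps f),
    summable_fun eta (fun x => cabs (truncated_op K eta eps f x) ^+ 2) &
    \int[eta]_x (cabs (truncated_op K eta eps f x) ^+ 2)
      <= complex_const * \int[eta]_x (cabs (f x) ^+ 2)].
Proof.
move=> mf sf.
pose f1 x := complex.Re (f x); pose f2 x := complex.Im (f x).
have q1 : summable_fun eta (fun x => f1 x ^+ 2) := summable_Re_sqr mf sf.
have q2 : summable_fun eta (fun x => f2 x ^+ 2) := summable_Im_sqr mf sf.
have [m1 m2] := mf.
have s1 := summable_sqr m1 q1; have s2 := summable_sqr m2 q2.
have ReT x := Re_truncated_op cz eps0 sepX x s1 s2.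
have ImT x := Im_truncated_op cz eps0 sepX x s1 s2.
pose g11 := cut_op u1 eps eta f1; pose g12 := cut_op u1 eps eta f2.
pose g21 := cut_op u2 eps eta f1; pose g22 := cut_op u2 eps eta f2.
have mg11 : measurable_fun setT g11 := measurable_cut_op rk1 eps0 eta sepX m1.
have mg12 : measurable_fun setT g12 := measurable_cut_op rk1 eps0 eta sepX m2.
have mg21 : measurable_fun setT g21 := measurable_cut_op rk2 eps0 eta sepX m1.
have mg22 : measurable_fun setT g22 := measurable_cut_op rk2 eps0 eta sepX m2.
have mT : cmeasurable (truncated_op K eta eps f).
  split.
    by under eq_fun do rewrite ReT; exact: measurable_funB.
  by under eq_fun do rewrite ImT; exact: measurable_funD.
have sq u (rk : real_kernel u A s delta) (h : borel X -> R) : summable_fun eta h ->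
    summable_fun eta (fun x => cut_op u eps eta h x ^+ 2).
  move=> sh; have mh := measurable_cut_op rk eps0 eta sepX (summable_measurable sh).
  apply: (@summable_bounded _ _ _ eta
    ((A / eps `^ s * \int[eta]_y `|h y|) ^+ 2)); first exact: measurable_funX.
  move=> x; have hb : `|cut_op u eps eta h x| <= A / eps `^ s * \int[eta]_y `|h y|.
    rewrite -RintZ; last exact: summable_norm.
    apply: le_norm_Rint => [||y].
    - exact: summable_measurable (summable_cut rk eps0 sepX x sh).
    - by apply: summableZ; exact: summable_norm.
    by rewrite normrM ler_wpM2r // (cut_le rk eps0).
  rewrite normrX lerXn2r // nnegrE.
  exact: le_trans hb.
have a11 := sq _ rk1 _ s1; have a12 := sq _ rk1 _ s2.
have a21 := sq _ rk2 _ s1; have a22 := sq _ rk2 _ s2.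
pose G x := 2 * ((g11 x ^+ 2 + g22 x ^+ 2) + (g12 x ^+ 2 + g21 x ^+ 2)).
have sG : summable_fun eta G.
  by apply: summableZ; apply: summableD; exact: summableD.
have TG x : cabs (truncated_op K eta eps f x) ^+ 2 <= G x.
  rewrite sqr_cabs ReT ImT -/(g11 x) -/(g22 x) -/(g12 x) -/(g21 x) /G.
  have := sqr_ge0 (g11 x + g22 x); have := sqr_ge0 (g12 x - g21 x).
  rewrite !expr2; lra.
have sT : summable_fun eta (fun x => cabs (truncated_op K eta eps f x) ^+ 2).
  apply: summable_dom sG; first exact: measurable_cabs_sqr.
  by move=> x; rewrite ger0_norm ?sqr_ge0 // (le_trans (TG x)) // ler_norm.
split => //; apply: le_trans (le_Rint sT sG TG) _.
rewrite RintZ; last by apply: summableD; exact: summableD.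
rewrite RintD; [|exact: summableD|exact: summableD].
rewrite !RintD //.
have r1 Q mQ := (@parts_restricted Q mQ).1.
have r2 Q mQ := (@parts_restricted Q mQ).2.
have C0 := normr_ge0 C.
have b11 := real_T1 rk1 eps0 sepX sig C0 r1 m1 q1.
have b12 := real_T1 rk1 eps0 sepX sig C0 r1 m2 q2.
have b21 := real_T1 rk2 eps0 sepX sig C0 r2 m1 q1.
have b22 := real_T1 rk2 eps0 sepX sig C0 r2 m2 q2.
have -> : \int[eta]_x (cabs (f x) ^+ 2) = \int[eta]_x (f1 x ^+ 2) + \int[eta]_x (f2 x ^+ 2).
  by rewrite -RintD //; apply: eq_Rintegral => x _; rewrite sqr_cabs.
rewrite /complex_const; set D := real_const _ _ _ _.
set p1 := \int[eta]_x (f1 x ^+ 2); set p2 := \int[eta]_x (f2 x ^+ 2).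
have -> : 4 * D * (p1 + p2) = 2 * ((D * p1 + D * p2) + (D * p2 + D * p1)) by ring.
by rewrite ler_wpM2l // lerD // lerD.
Qed.

End ComplexT1.

(** * The uniform bound on the operator norm *)

Lemma real_const_ge0 {R : realType} (A s delta C : R) : 0 <= real_const A s delta C.
Proof.
rewrite /real_const; set c := discrete_const _ _ _ _ _.
have c0 : 0 <= c by rewrite /c /discrete_const mulr_ge0 // sqr_ge0.
have := sqr_ge0 (schur_const A s); lra.
Qed.

Unset Implicit Arguments.

Theorem theorem2p4 (R : realType) (A s delta C : R) :
  exists C' : R,
    forall (X : pmetricType R) (K : X -> X -> R[i])
      (eta : {finite_measure set (borel X) -> \bar R}),
    separable X ->
    CZ_kernel A s delta K ->
    Sigma s eta ->
    (forall (Q : set (borel X)) (mQ : measurable Q) (eps : R), 0 < eps ->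
      (L2norm (mrestr eta mQ) (truncated_op K eta eps \1_Q) ^+ 2
         <= C%:E * eta Q)%E) ->
    forall eps : R, 0 < eps ->
      (forall f : borel X -> R[i],
         inL2 eta f -> inL2 eta (truncated_op K eta eps f)) /\
      (L2_opnorm eta (truncated_op K eta eps) <= C'%:E)%E.
Proof.
(* [complex_const] bounds squared norms, hence the root. *)
exists (Num.sqrt (complex_const A s delta C)) => X K eta sepX cz sig restr eps eps0.
have restr' (Q : set (borel X)) (mQ : measurable Q) := restr Q mQ eps eps0.
have key f (hf : inL2 eta f) :=
  truncated_op_L2 cz eps0 sepX sig restr' hf.1 ((inL2P eta hf.1).1 hf).
split=> [f hf|].
  by have [mT sT _] := key f hf; exact/(inL2P eta mT).
apply: ge_ereal_sup => _ [f [hf f1] <-].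
have [mT sT le] := key f hf.
have sf := (inL2P eta hf.1).1 hf.
have C0 : 0 <= complex_const A s delta C.
  by rewrite mulr_ge0 // real_const_ge0.
rewrite (L2norm_summable sT) lee_fin ler_wsqrtr //; apply: le_trans le _.
rewrite -[leRHS]mulr1 ler_wpM2l //.
move: f1; rewrite (L2norm_summable sf) lee_fin -[X in _ <= X]sqrtr1 ler_sqrt //.
Qed.
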